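(* Let $\mathcal{H}$ be a complex Hilbert space, let $f:\mathbb{D}\to\mathcal{B}(\mathcal{H})$ be a normalized starlike biholomorphic function with expansion $f(z)=zI+\sum_{n=2}^{\infty}A_nz^n$, and let $g\in S(f)$ with expansion $g(z)=\sum_{k=0}^{\infty}B_kz^k$, $z\in\mathbb{D}$. Then for all $0\le r\le 3-2\sqrt2$: (i) $\displaystyle\sum_{k=1}^{\infty}\|B_k\|r^k\le \liminf_{|z|\to1-}\|f(z)\|$; (ii) $\displaystyle\sum_{k=1}^{\infty}|B_k|r^k\le \tfrac14 I$.
   Context: $\mathbb{D}=\{z\in\mathbb{C}:|z|<1\}$. $\mathcal{B}(\mathcal{H})$ is the set of bounded linear operators on $\mathcal{H}$ (a complex Banach space with the operator norm $\|\cdot\|$), $I$ is the identity operator, and $|A|=(A^*A)^{1/2}$ (unique positive square root). For self-adjoint $A,B\in\mathcal{B}(\mathcal{H})$, $A\le B$ means $\langle Ax,x\rangle\le\langle Bx,x\rangle$ for all $x\in\mathcal{H}$. Given complex Banach spaces $X,Y$ and a domain $D\subset X$, a holomorphic mapping $f:D\to Y$ is biholomorphic on $D$ if $f(D)$ is a domain in $Y$ and $f^{-1}$ exists and is holomorphic on $f(D)$. A biholomorphic function $f$ on $D$ is starlike with respect to $z_0\in D$ if $(1-t)f(z_0)+tf(z)\in f(D)$ for all $z\in D$ and $t\in[0,1]$; $f$ is called starlike biholomorphic on $D$ if $f$ is starlike with respect to $0\in D$ and $f(0)=0$. Here $D=\mathbb{D}$, $X=\mathbb{C}$, $Y=\mathcal{B}(\mathcal{H})$;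 normalized means $f(0)=0$ and $f'(0)=I$. For a holomorphic $f:\mathbb{D}\to\mathcal{B}(\mathcal{H})$, $S(f)$ denotes the class of holomorphic functions $g:\mathbb{D}\to\mathcal{B}(\mathcal{H})$ subordinate to $f$, i.e. such that $g=f\circ\phi$ for some holomorphic $\phi:\mathbb{D}\to\mathbb{C}$ with $\phi(0)=0$ and $|\phi(z)|<1$ for all $z\in\mathbb{D}$. *)

(* Defs.v *)
From HB Require Import structures.
From mathcomp Require Import all_boot all_order all_algebra.
From mathcomp Require Import sesquilinear.
From mathcomp Require Import all_classical all_reals all_analysis.
From mathcomp Require Import complex.

Set Implicit Arguments.
Unset Strict Implicit.
Unset Printing Implicit Defensive.

Import Order.TTheory GRing.Theory Num.Theory.
Import numFieldNormedType.Exports.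

Local Open Scope classical_set_scope.
Local Open Scope ring_scope.
Local Open Scope complex_scope.

Local Notation Re := complex.Re.

HB.instance Definition _ (R : realType) := NormedModule.copy R[i] R[i]^o.

Section bounded_operators.
Context {R : realType} {H : normedModType R[i]}.

Definition bounded_linear : {pred H -> H} := fun A =>
  `[< linear A /\ exists M : R, forall x, `|A x| <= M%:C * `|x| >].

Lemma bounded_linearP (A : H -> H) :
  reflect (linear A /\ exists M : R, forall x, `|A x| <= M%:C * `|x|)
          (A \in bounded_linear).
Proof. exact: asboolP. Qed.

Lemma normcE (V : normedZmodType R[i]) (x : V) : `|x| = (Re `|x|)%:C.
Proof. by rewrite RRe_real// normr_real. Qed.

Lemma real_complexD (a b : R) : (a + b)%:C = a%:C + b%:C.
Proof. exact: rmorphD. Qed.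

Lemma real_complexM (a b : R) : (a * b)%:C = a%:C * b%:C.
Proof. exact: rmorphM. Qed.

Lemma bounded_linear_submod : submod_closed bounded_linear.
Proof.
split.
  apply/bounded_linearP; split; first by move=> a x y; rewrite scaler0 addr0.
  by exists 0 => x; rewrite normr0 mul0r.
move=> c A B /bounded_linearP[lA [M hM]] /bounded_linearP[lB [N hN]].
apply/bounded_linearP; split.
  move=> a x y; rewrite !fctE lA lB !scalerDr !scalerA (mulrC c) -!addrA.
  by congr (_ + _); rewrite addrCA.
exists (Re `|c| * M + N) => x; rewrite !fctE real_complexD real_complexM -normcE mulrDl.
rewrite (le_trans (ler_normD _ _))// lerD// normrZ -mulrA.
by rewrite ler_wpM2l.
Qed.

HB.instance Definition _ :=
  GRing.isSubmodClosed.Build R[i] (H -> H) bounded_linear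
    bounded_linear_submod.

End bounded_operators.

Record bop (R : realType) (H : normedModType R[i]) :=
  Bop { bop_fun :> H -> H; _ : bop_fun \in bounded_linear }.
Arguments Bop {R H}.

Section bop_normed_module.
Context {R : realType} {H : normedModType R[i]}.
Local Notation BH := (bop H).

HB.instance Definition _ := [isSub for @bop_fun R H].
HB.instance Definition _ := [Choice of BH by <:].
HB.instance Definition _ := [SubChoice_isSubLmodule of BH by <:].

Definition opnorm (A : BH) : R :=
  sup [set Re `|A x| | x in [set x : H | `|x| <= 1]].

Implicit Types (A B : BH) (x y : H).

Lemma bopP A : linear A /\ exists M : R, forall x, `|A x| <= M%:C * `|x|.
Proof. by apply/bounded_linearP; exact: valP. Qed.

Lemma bop_eqP A B : A =1 B -> A = B.
Proof. by move=> AB; apply/val_inj/funext. Qed.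

Lemma bopZ A (a : R[i]) x : A (a *: x) = a *: A x.
Proof.
have [lA _] := bopP A; have A0 : A 0 = 0.
  by have := lA (-1) 0 0; rewrite scaleN1r oppr0 addr0 scaleN1r addNr.
by have := lA a x 0; rewrite A0 !addr0.
Qed.

Lemma bop0 A : A 0 = 0.
Proof. by rewrite -(scale0r (0 : H)) bopZ !scale0r. Qed.

Lemma opnorm_has_sup A :
  has_sup [set Re `|A x| | x in [set x : H | `|x| <= 1]].
Proof.
split; first by exists (Re `|A 0|), 0 => //=; rewrite normr0.
have [_ [M hM]] := bopP A; exists `|M| => _ [x /= x1 <-].
rewrite -lecR -normcE (le_trans (hM x))//.
rewrite (le_trans (_ : _ <= `|M|%:C * `|x|))//.
  by rewrite ler_wpM2r// lecR ler_norm.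
by rewrite ler_piMr// ler0c.
Qed.

Lemma opnorm_ub A x : `|x| <= 1 -> Re `|A x| <= opnorm A.
Proof.
by move=> x1; apply: ub_le_sup; [case: (opnorm_has_sup A)|exists x].
Qed.

Lemma opnorm_ge0 A : 0 <= opnorm A.
Proof.
apply: (le_trans _ (@opnorm_ub A 0 _)); last by rewrite normr0.
by rewrite -ler0c -normcE.
Qed.

Lemma opnorm_le A (M : R) :
  (forall x, `|x| <= 1 -> Re `|A x| <= M) -> opnorm A <= M.
Proof.
move=> hM; apply: ge_sup; first by case: (opnorm_has_sup A).
by move=> _ [x x1 <-]; exact: hM.
Qed.

Lemma opnormP A x : `|A x| <= (opnorm A)%:C * `|x|.
Proof.
have [->|x0] := eqVneq x 0.
  by rewrite bop0 !normr0 mulr0.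
have nx0 : 0 < `|x| by rewrite normr_gt0.
rewrite -ler_pdivrMr// mulrC.
have -> : `|x|^-1 * `|A x| = `|A (`|x|^-1 *: x)|.
  by rewrite bopZ normrZ normfV normr_id.
rewrite normcE lecR opnorm_ub// normrZ normfV normr_id mulVf//.
by rewrite gt_eqF.
Qed.

Let norm A : R[i] := (opnorm A)%:C.

Let ler_normD A B : norm (A + B) <= norm A + norm B.
Proof.
rewrite -real_complexD lecR; apply: opnorm_le => x x1.
rewrite -lecR -normcE real_complexD (le_trans (ler_normD _ _))// lerD//.
  by rewrite normcE lecR opnorm_ub.
by rewrite normcE lecR opnorm_ub.
Qed.

Let opnormZ_le a A : opnorm (a *: A) <= Re `|a| * opnorm A.
Proof.
apply: opnorm_le => x x1.
rewrite -lecR -normcE real_complexM -normcE.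
have -> : (a *: A) x = a *: A x by [].
by rewrite normrZ ler_wpM2l// normcE lecR opnorm_ub.
Qed.

Let normrZ a A : norm (a *: A) = `|a| * norm A.
Proof.
rewrite [`|a|]normcE -real_complexM; congr _%:C; apply/eqP.
rewrite eq_le opnormZ_le andTb.
have [->|a0] := eqVneq a 0; first by rewrite normr0 mul0r opnorm_ge0.
have := opnormZ_le a^-1 (a *: A); rewrite scalerA mulVf// scale1r.
rewrite -lecR real_complexM -normcE normfV mulrC ler_pdivlMr ?normr_gt0//.
by rewrite normcE -real_complexM lecR mulrC.
Qed.

Let normr0_eq0 A : norm A = 0 -> A = 0.
Proof.
move=> A0; apply: bop_eqP => x; apply/eqP; rewrite -normr_le0.
by rewrite (le_trans (opnormP A x))// -/(norm A) A0 mul0r.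
Qed.

HB.instance Definition _ :=
  Lmodule_isNormed.Build R[i] BH ler_normD normrZ normr0_eq0.

Lemma bop_normE A : `|A| = (opnorm A)%:C. Proof. by []. Qed.

Lemma idbop_subproof : (idfun : H -> H) \in bounded_linear.
Proof.
by apply/bounded_linearP; split=> //; exists 1 => x; rewrite mul1r.
Qed.

Definition idbop : BH := Bop idfun idbop_subproof.

Lemma compbop_subproof A B : A \o B \in bounded_linear.
Proof.
have [[lA _] [lB _]] := (bopP A, bopP B).
apply/bounded_linearP; split; first by move=> a x y; rewrite /= lB lA.
exists (opnorm A * opnorm B) => x; rewrite real_complexM -mulrA.
by rewrite (le_trans (opnormP A _))// ler_wpM2l ?opnormP// ler0c opnorm_ge0.
Qed.

Definition compbop A B : BH := Bop (A \o B) (compbop_subproof A B).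

End bop_normed_module.
Arguments idbop {R} H.

Section operator_order.
Context {R : realType} {H : normedModType R[i]}.
Variable dot : {dot H for @Num.conj R[i]}.
Implicit Types A B P : bop H.

Definition is_adjoint A B := forall x y, dot (A x) y = dot x (B y).

(* On a Hilbert space the adjoint exists (Riesz) and is unique; likewise the
   positive square root selected in [absop]. *)
Definition adjoint A : bop H := get [set B | is_adjoint A B].

Definition selfadjoint A := is_adjoint A A.

(* The order of R[i] makes [a <= b] mean that [b - a] is real and
   nonnegative; both sides here are real by self-adjointness. *)
Definition op_le A B :=
  [/\ selfadjoint A, selfadjoint B & forall x, dot (A x) x <= dot (B x) x].

Definition absop A : bop H :=
  get [set P | op_le 0 P /\ compbop P P = compbop (adjoint A) A].

End operator_order.

Definition is_domain (T : topologicalType) (D : set T) :=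
  [/\ D !=set0, open D & connected D].

Section holomorphic_maps.
Context {R : realType}.

(* Maps on a domain D are total functions whose values outside D are
   irrelevant: D being open, Frechet differentiability at the points of D only
   depends on the restriction to D. *)
Definition holomorphic (X Y : normedModType R[i]) (D : set X) (f : X -> Y) :=
  forall z, D z -> differentiable f z.

Definition biholomorphic (X Y : normedModType R[i]) (D : set X) (f : X -> Y) :=
  [/\ holomorphic D f, is_domain (f @` D) &
      exists h : Y -> X,
        (forall z, D z -> h (f z) = z) /\ holomorphic (f @` D) h].

Definition starlike_wrt (X Y : normedModType R[i]) (D : set X) (z0 : X)
    (f : X -> Y) :=
  [/\ biholomorphic D f, D z0 &
      forall z (t : R), D z -> 0 <= t <= 1 ->
        (f @` D) ((1 - t)%:C *: f z0 + t%:C *: f z)].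

Definition starlike_biholomorphic (X Y : normedModType R[i]) (D : set X)
    (f : X -> Y) := starlike_wrt D 0 f /\ f 0 = 0.

End holomorphic_maps.

Section unit_disk.
Context {R : realType}.

Definition unit_disk : set R[i] := [set z | `|z| < 1].

Definition normalized (H : normedModType R[i]) (f : R[i] -> bop H) :=
  f 0 = 0 /\ is_derive (0 : R[i]) (1 : R[i]) f (idbop H).

Definition subordinate (Y : normedModType R[i]) (f g : R[i] -> Y) :=
  holomorphic unit_disk g /\
  exists phi : R[i] -> R[i],
    [/\ holomorphic unit_disk phi, phi 0 = 0,
        forall z, unit_disk z -> `|phi z| < 1 &
        forall z, unit_disk z -> g z = f (phi z)].

(* The filter of the limit |z| -> 1-, generated by the annuli. *)
Definition norm_to_1 : set_system R[i] :=
  filter_from [set rho : R | rho < 1]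
    (fun rho => [set z : R[i] | rho%:C < `|z| < 1]).

End unit_disk.
Arguments unit_disk : clear implicits.
Arguments norm_to_1 : clear implicits.

(* Main.v *)
Require Import Defs.
From HB Require Import structures.
From mathcomp Require Import all_boot all_order all_algebra.
From mathcomp Require Import sesquilinear.
From mathcomp Require Import all_classical all_reals all_analysis.
From mathcomp Require Import complex separable cyclotomic.
From mathcomp Require Import ring lra.
Import Order.TTheory GRing.Theory Num.Theory.
Import numFieldNormedType.Exports.
Local Open Scope classical_set_scope.
Local Open Scope ring_scope.
Local Open Scope complex_scope.

(** A biholomorphic map of the disk onto a domain of [bop H] has a bijective
    differential at [0], here [z |-> z *: idbop H].  So every bounded operator
    on [H] is a scalar multiple of the identity
    ([biholomorphic_scalar_operators]), and both inequalities are statements on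
    a normalized starlike univalent function [F], a function [G = F \o phi]
    subordinate to it, and the coefficients [b] of [G].  They follow from
<<
         \sum_(k < K) cabs (b k) * r ^+ k <= 4^-1 <= liminf (cabs (F z)).
>>
    The left inequality ([starlike_subordinate_majorant]) combines two facts.
    Subordination does not increase the majorant series of [F] at radius at most
    [1/3], a consequence of Bohr's theorem ([majorant_subordinate]).  The [n]-th
    coefficient of [F] is at most [n] ([starlike_coef]), so that the majorant of
    [F] is at most [r / (1 - r) ^+ 2], which is [1/4] at [r = 3 - 2 sqrt 2].  The
    coefficient bound holds because [z F' / F] has nonnegative real part:
    [z |-> F^-1 (t F z)] maps the disk to itself and fixes [0], hence does not
    increase the modulus, and its derivative at [t = 1] is [F / F'].

    The right inequality is the quarter bound [cabs z / 4 <= cabs (F z)]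
    ([starlike_quarter]): a starlike set which omits [w] omits the ray from [w]
    to infinity, so that [1 - F / w], rescaled to the disk on which [w] is
    omitted, has a square root of positive real part.

    Everything else is Caratheodory's inequality, [cabs (p n) <= 2 * p 0] for a
    function of nonnegative real part with [p 0] real.  It is derived without
    contour integrals.  Holomorphy enters through [smooth]: expansions of every
    order at every point, a property stable under the operations needed,
    including the passage to an inverse function, and satisfied by power series
    because their divided differences are again power series
    ([pseries_divided_difference]).  Expansions of order two give the maximum
    principle, averaging over the four points [z0 + d * 'i ^+ k]
    ([maximum_Re]).  Schwarz's lemma follows, and averaging over the [n]-th roots
    of unity reduces Caratheodory's inequality for the [n]-th coefficient to
    Schwarz's lemma for a function with a zero of order [n] at [0]. *)

Set Implicit Arguments.
Unset Strict Implicit.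
Unset Printing Implicit Defensive.

Local Notation Re := complex.Re.
Local Notation Im := complex.Im.

(** * Real-valued modulus and neighbourhoods in R[i] *)

Section modulus.
Context {R : realType}.
Local Notation C := R[i].

Definition cabs (z : C) : R := Re `|z|.

Lemma cabsE (z : C) : `|z| = (cabs z)%:C.
Proof. exact: Defs.normcE. Qed.

Lemma cabs_ge0 (z : C) : 0 <= cabs z.
Proof. by rewrite -ler0c -cabsE. Qed.

Lemma cabsM (z w : C) : cabs (z * w) = cabs z * cabs w.
Proof. by apply: (@complexI R); rewrite rmorphM/= -!cabsE normrM. Qed.

Lemma cabsD (z w : C) : cabs (z + w) <= cabs z + cabs w.
Proof. by rewrite -lecR rmorphD/= -!cabsE ler_normD. Qed.

Lemma cabsN (z : C) : cabs (- z) = cabs z.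
Proof. by rewrite /cabs normrN. Qed.

Lemma cabsB (z w : C) : cabs (z - w) = cabs (w - z).
Proof. by rewrite /cabs distrC. Qed.

Lemma cabs0 : cabs 0 = 0.
Proof. by rewrite /cabs normr0. Qed.

Lemma cabs1 : cabs 1 = 1.
Proof. by rewrite /cabs normr1. Qed.

Lemma cabsV (z : C) : cabs z^-1 = (cabs z)^-1.
Proof. by apply: (@complexI R); rewrite fmorphV/= -!cabsE normfV. Qed.

Lemma cabsX (z : C) n : cabs (z ^+ n) = cabs z ^+ n.
Proof. by elim: n => [|n IH]; rewrite ?cabs1// !exprS cabsM IH. Qed.

Lemma cabs_eq0 (z : C) : (cabs z == 0) = (z == 0).
Proof.
rewrite -[RHS]normr_eq0 cabsE; apply/eqP/eqP => [->//|]; exact: (@complexI R).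
Qed.

Lemma cabs_gt0 (z : C) : (0 < cabs z) = (z != 0).
Proof. by rewrite lt_neqAle cabs_ge0 andbT eq_sym cabs_eq0. Qed.

Lemma cabs_real (x : R) : cabs x%:C = `|x|.
Proof. by rewrite /cabs normc_def/= expr0n addr0 sqrtr_sqr. Qed.

Lemma cabs_sqr (z : C) : cabs z ^+ 2 = Re z ^+ 2 + Im z ^+ 2.
Proof. by rewrite /cabs normc_def/= sqr_sqrtr// addr_ge0// sqr_ge0. Qed.

Lemma ReD (z w : C) : Re (z + w) = Re z + Re w.
Proof. by case: z; case: w. Qed.

Lemma ReN (z : C) : Re (- z) = - Re z.
Proof. by case: z. Qed.

Lemma ReM (z w : C) : Re (z * w) = Re z * Re w - Im z * Im w.
Proof. by case: z; case: w. Qed.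

Lemma ReZ (x : R) (z : C) : Re (x%:C * z) = x * Re z.
Proof. by rewrite ReM/= mul0r subr0. Qed.

Lemma Re_le_cabs (z : C) : Re z <= cabs z.
Proof.
by have := normc_ge_Re z; rewrite cabsE lecR; apply: le_trans; rewrite ler_norm.
Qed.

Lemma cabs_le (z : C) : cabs z <= `|Re z| + `|Im z|.
Proof.
rewrite -(@ler_pXn2r _ 2)// ?nnegrE ?cabs_ge0 ?addr_ge0// cabs_sqr.
rewrite sqrrD !real_normK ?num_real// lerD2r lerDl.
by rewrite mulrn_wge0// mulr_ge0.
Qed.

Lemma disk_cabs (z : C) : unit_disk R z <-> cabs z < 1.
Proof. by rewrite /unit_disk/= cabsE ltcR. Qed.

Lemma conj_mul_cabs (z : C) : z^* * z = (cabs z ^+ 2)%:C.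
Proof. by rewrite mulrC -sqr_normc cabsE rmorphXn. Qed.

End modulus.

Section local.
Context {R : realType}.
Local Notation C := R[i].

Lemma nearC (z0 : C) (P : C -> Prop) :
  (\forall z \near z0, P z) <->
  exists2 d : R, 0 < d & forall z, cabs (z - z0) < d -> P z.
Proof.
split.
  case/nbhs_ballP => e /= e0 sub.
  have eE : e = (Re e)%:C by rewrite RRe_real// gtr0_real.
  exists (Re e); first by rewrite -ltcR -eE.
  move=> z zd; apply: sub; rewrite -ball_normE/=.
  by rewrite distrC cabsE eE ltcR.
case=> d d0 sub; apply/nbhs_ballP; exists d%:C => /=; first by rewrite ltcR.
move=> z; rewrite -ball_normE/= distrC cabsE ltcR; exact: sub.
Qed.

Lemma cvgC (T : Type) (F : set_system T) (FF : Filter F) (u : T -> C) (l : C) :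
  (u @ F --> l) <-> forall e : R, 0 < e -> \forall x \near F, cabs (u x - l) < e.
Proof.
rewrite cvgrPdist_lt; split=> h e e0.
  by move: (h e%:C); rewrite ltcR => /(_ e0); apply: filterS => x;
    rewrite distrC cabsE ltcR.
have eE : e = (Re e)%:C by rewrite RRe_real// gtr0_real.
move: e0; rewrite eE ltcR => /h; apply: filterS => x.
by rewrite distrC cabsE ltcR.
Qed.

Lemma disk_open (z0 : C) : cabs z0 < 1 -> \forall z \near z0, cabs z < 1.
Proof.
move=> h; apply/nearC; exists (1 - cabs z0); first by rewrite subr_gt0.
move=> z hz; have := cabsD (z - z0) z0; rewrite subrK; lra.
Qed.

End local.

(** * Functions with expansions of every order at a point *)

Lemma near_all (T : topologicalType) (x : T) (P : T -> Prop) :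
  (forall y, P y) -> \forall y \near x, P y.
Proof. exact: nearW. Qed.

Lemma near_imp (T : topologicalType) (x : T) (P Q : T -> Prop) :
  (forall y, P y -> Q y) -> (\forall y \near x, P y) -> \forall y \near x, Q y.
Proof. by move=> PQ; apply: filterS. Qed.

Lemma near_and (T : topologicalType) (x : T) (P Q : T -> Prop) :
  (\forall y \near x, P y) -> (\forall y \near x, Q y) ->
  \forall y \near x, P y /\ Q y.
Proof. exact: filterI. Qed.

Section continuity_at.
Context {T : topologicalType} {K : numFieldType}.
Implicit Types (u v : T -> K) (x : T).

Lemma near_continuous u v x : (\forall y \near x, u y = v y) ->
  {for x, continuous v} -> {for x, continuous u}.
Proof.
move=> uv; rewrite /prop_for /continuous_at (nbhs_singleton uv); apply: cvg_trans.
by apply: near_eq_cvg; near=> z; apply/esym; near: z.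
Unshelve. all: by end_near. Qed.

Lemma continuous_cst (c : K) x : {for x, continuous (fun=> c)}.
Proof. exact: cvg_cst. Qed.

Lemma near_neq0 u x : {for x, continuous u} -> u x != 0 ->
  \forall y \near x, u y != 0.
Proof.
move=> /cvgrPdist_lt cu; rewrite -normr_gt0 => u0; have := cu _ u0.
by apply: filterS => z; apply: contraTneq => ->; rewrite subr0 ltxx.
Qed.

End continuity_at.

Lemma continuous_id (T : topologicalType) (x : T) : {for x, continuous (@id T)}.
Proof. exact: cvg_id. Qed.

Section smooth.
Context {C : numFieldType}.
Implicit Types (u v w : C -> C) (z : C) (n : nat).

(** Caratheodory's form of an expansion of order [n] at [z0]: divided differences,
    iterated [n] times, end in a function continuous at [z0].  It passes through products,
    inverses and compositions by algebra, without estimates of remainders. *)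
Fixpoint smooth n u z0 : Prop :=
  if n is m.+1 then
    exists2 v, smooth m v z0 & \forall z \near z0, u z = u z0 + (z - z0) * v z
  else {for z0, continuous u}.

Lemma smooth_continuous n u z0 : smooth n u z0 -> {for z0, continuous u}.
Proof.
elim: n u => [//|n IH] u [v /IH cv uE].
apply: (near_continuous uE); apply: continuousD; first exact: continuous_cst.
apply: continuousM => //; apply: continuousB; last exact: continuous_cst.
exact: continuous_id.
Qed.

Lemma smoothS n u z0 : smooth n.+1 u z0 -> smooth n u z0.
Proof.
elim: n u => [|n IH] u; first exact: smooth_continuous.
by case=> v sv uE; exists v => //; apply: IH.
Qed.

Lemma smooth_near n u v z0 : (\forall z \near z0, u z = v z) ->
  smooth n v z0 -> smooth n u z0.
Proof.
case: n => [|n] uv; first exact: near_continuous.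
case=> w sw vE; exists w => //; rewrite (nbhs_singleton uv).
by apply: filterS2 uv vE => z -> ->.
Qed.

Lemma smooth_cst n (c : C) z0 : smooth n (fun=> c) z0.
Proof.
elim: n c => [|n IH] c; first exact: continuous_cst.
by exists (fun=> 0) => //; apply: near_all => z; rewrite mulr0 addr0.
Qed.

Lemma smooth_id n z0 : smooth n id z0.
Proof.
case: n => [|n]; first exact: continuous_id.
by exists (fun=> 1); [exact: smooth_cst|apply: near_all => z; rewrite mulr1 subrKC].
Qed.

Lemma smoothD n u v z0 :
  smooth n u z0 -> smooth n v z0 -> smooth n (fun z => u z + v z) z0.
Proof.
elim: n u v => [|n IH] u v; first exact: continuousD.
move=> [u1 su uE] [v1 sv vE]; exists (fun z => u1 z + v1 z); first exact: IH.
by apply: filterS2 uE vE => z -> ->; ring.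
Qed.

Lemma smoothM n u v z0 :
  smooth n u z0 -> smooth n v z0 -> smooth n (fun z => u z * v z) z0.
Proof.
elim: n u v => [|n IH] u v su sv; first exact: continuousM.
have [[u1 su1 uE] [v1 sv1 vE]] := (su, sv).
exists (fun z => u1 z * v z + u z0 * v1 z).
  by apply: smoothD; apply: IH => //; [exact: smoothS|exact: smooth_cst].
by apply: filterS2 uE vE => z -> vE; rewrite {1}vE [in RHS]vE; ring.
Qed.

Lemma smoothN n u z0 : smooth n u z0 -> smooth n (fun z => - u z) z0.
Proof.
move=> su; apply: (smooth_near _ (smoothM (smooth_cst n (-1) z0) su)).
by apply: near_all => z; rewrite mulN1r.
Qed.

Lemma smoothB n u v z0 :
  smooth n u z0 -> smooth n v z0 -> smooth n (fun z => u z - v z) z0.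
Proof. by move=> su sv; apply: smoothD => //; apply: smoothN. Qed.

Lemma smoothV n u z0 : u z0 != 0 ->
  smooth n u z0 -> smooth n (fun z => (u z)^-1) z0.
Proof.
move=> u0; elim: n => [|n IH] su; first exact: continuousV.
have [v sv uE] := su; exists (fun z => - (u z0)^-1 * (v z * (u z)^-1)).
  apply: smoothM; first exact: smooth_cst.
  by apply: smoothM => //; apply: IH; apply: smoothS.
apply: filterS2 uE (near_neq0 (smooth_continuous su) u0) => z uE uz.
have [->|zz] := eqVneq z z0; first by rewrite subrr mul0r addr0.
have -> : v z = (u z - u z0) / (z - z0).
  by rewrite uE addrC addKr mulrC mulKf// subr_eq0.
by field; rewrite u0 uz subr_eq0 zz.
Qed.

Lemma smooth_comp n u v z0 :
  smooth n u z0 -> smooth n v (u z0) -> smooth n (fun z => v (u z)) z0.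
Proof.
elim: n v => [|n IH] v su sv; first exact: continuous_comp su sv.
have [[u1 su1 uE] [v1 sv1 vE]] := (su, sv).
exists (fun z => u1 z * v1 (u z)).
  by apply: smoothM => //; apply: IH => //; apply: smoothS.
have vuE : \forall z \near z0, v (u z) = v (u z0) + (u z - u z0) * v1 (u z).
  exact: (smooth_continuous su vE).
apply: filterS2 uE vuE => z uE ->.
have -> : u z - u z0 = (z - z0) * u1 z by rewrite uE addrC addKr.
by rewrite mulrA.
Qed.

(** [w] is the divided difference, at [v z0], of the map that [v] inverts.
    The increment of [v] is thus [(z - z0) / w (v z)], which has one more order
    of smoothness than [v] itself. *)
Lemma smooth_inverse v w z0 :
  {for z0, continuous v} -> (forall n, smooth n w (v z0)) -> w (v z0) != 0 ->
  (\forall z \near z0, z = z0 + (v z - v z0) * w (v z)) ->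
  forall n, smooth n v z0.
Proof.
move=> cv sw w0 vE; elim=> [//|n IH].
exists (fun z => (w (v z))^-1).
  by apply: smoothV => //; apply: smooth_comp.
have wv0 : \forall z \near z0, w (v z) != 0.
  by apply: near_neq0 => //; apply: (smooth_continuous (smooth_comp IH (sw n))).
apply: filterS2 vE wv0 => z zE wz.
have -> : z - z0 = (v z - v z0) * w (v z).
  by rewrite [LHS](congr1 (+%R^~ (- z0)) zE) addrC addKr.
by rewrite mulfK// subrKC.
Qed.

End smooth.

(** * The maximum principle *)

Section maximum_principle.
Context {R : realType}.
Local Notation C := R[i].
Implicit Types (z : C) (u v w : C -> C).

Lemma continuousC (T : topologicalType) (u : T -> C) (x : T) :
  {for x, continuous u} <->
  forall e : R, 0 < e -> \forall y \near x, cabs (u y - u x) < e.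
Proof. exact: cvgC. Qed.

Lemma continuous_Re (T : topologicalType) (u : T -> C) (x : T) :
  {for x, continuous u} -> {for x, continuous (fun y => Re (u y))}.
Proof.
move=> /continuousC cu; apply/cvgrPdist_lt => e e0.
have := cu e e0; apply: filterS => y; apply: le_lt_trans.
by rewrite distrC -ReN -ReD -lecR -cabsE normc_ge_Re.
Qed.

Lemma continuous_cabs (T : topologicalType) (u : T -> C) (x : T) :
  {for x, continuous u} -> {for x, continuous (fun y => cabs (u y))}.
Proof.
move=> /continuousC cu; apply/cvgrPdist_lt => e e0.
have := cu e e0; apply: filterS => y; apply: le_lt_trans.
have := cabsD (u y - u x) (u x); have := cabsD (u x - u y) (u y).
by rewrite !subrK (cabsB (u x)) ler_norml => *; apply/andP; split; lra.
Qed.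

Let j (p : R * R) : C := p.1 +i* p.2.

Let j_continuous p : {for p, continuous j}.
Proof.
apply/continuousC => e e0.
have c1 : {for p, continuous (@fst R R)} by exact: cvg_fst.
have c2 : {for p, continuous (@snd R R)} by exact: cvg_snd.
move/cvgrPdist_lt: c1 => /(_ (e / 2)) c1; move/cvgrPdist_lt: c2 => /(_ (e / 2)) c2.
have e20 : 0 < e / 2 by lra.
apply: filterS2 (c1 e20) (c2 e20) => q q1 q2.
apply: le_lt_trans (cabs_le _) _; rewrite /= [ltRHS]splitr.
by rewrite ltrD// distrC.
Qed.

(** The closed disk of [R[i]] is the image of a compact subset of a square of
    [R * R]. *)
Lemma disk_EVT (g : C -> R) (rho : R) : 0 <= rho ->
  (forall z, cabs z <= rho -> {for z, continuous g}) ->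
  exists2 z0, cabs z0 <= rho & forall z, cabs z <= rho -> g z <= g z0.
Proof.
move=> rho0 cg; pose K := [set p : R * R | cabs (j p) <= rho].
have cK : compact K.
  apply: (@subclosed_compact _ K (`[- rho, rho] `*` `[- rho, rho])).
  - have -> : K = (fun p => cabs (j p)) @^-1` [set x | x <= rho] by [].
    apply: closed_comp; last exact: closed_le.
    by move=> p _; apply: continuous_cabs; exact: j_continuous.
  - by apply: compact_setX; exact: segment_compact.
  - move=> [x y]; rewrite /K /j /= => xy.
    have := cabs_sqr (x +i* y); rewrite /= !in_itv/= => e.
    have e0 := cabs_ge0 (x +i* y).
    split; apply/andP; split; nra.
have K0 : K !=set0 by exists (0, 0); rewrite /K /j/= cabs0.
have [|p pK pmax] := @compact_EVT_max _ _ (g \o j) K K0 cK.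
  apply: continuous_in_subspaceT => p; rewrite inE => pK.
  apply: continuous_comp; first exact: j_continuous.
  exact: cg.
exists (j p); first by move: pK; rewrite inE.
move=> z zr; have jz : j (Re z, Im z) = z by case: z {zr}.
by have := pmax (Re z, Im z); rewrite inE /K /= jz; apply.
Qed.

Lemma continuous_addR (T : topologicalType) (f g : T -> R) (x : T) :
  {for x, continuous f} -> {for x, continuous g} ->
  {for x, continuous (fun y => f y + g y)}.
Proof. exact: continuousD. Qed.

(** Averaging over the four points [z0 + d * 'i^k] kills the terms of degree 1
    and 2 of the expansion of [u] at [z0], while it raises [cabs z ^+ 2] by
    [d ^+ 2]; hence [Re u + e * cabs ^+ 2] has no interior maximum. *)
Lemma maximum_Re u (rho M : R) : 0 <= rho < 1 ->
  (forall z, cabs z < 1 -> smooth 2 u z) ->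
  (forall z, cabs z = rho -> Re (u z) <= M) ->
  forall z, cabs z <= rho -> Re (u z) <= M.
Proof.
move=> /andP[rho0 rho1] su uM z zr.
apply/ler_addgt0Pr => e e0.
pose g z := Re (u z) + e * cabs z ^+ 2.
have [//|y|z0 z0r gmax] := @disk_EVT g rho.
  move=> yr; apply: continuous_addR.
    apply: continuous_Re; apply: (@smooth_continuous _ 2); apply: su.
    exact: le_lt_trans yr rho1.
  apply: continuousM; first exact: continuous_cst.
  by apply: continuousM; apply: continuous_cabs; exact: continuous_id.
have gz := gmax z zr.
have gz0 : g z0 <= M + e.
  have [z0E|z0E] := eqVneq (cabs z0) rho.
    by rewrite /g z0E lerD ?uM// ger_pMr// expr_le1// ltW.
  have {z0E}z0r' : cabs z0 < rho by rewrite lt_neqAle z0E.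
  have [v [w cw vE] uE] := su z0 (lt_trans z0r' rho1).
  have e20 : 0 < e / 2 by lra.
  have /continuousC/(_ _ e20) cw' := cw.
  have nr : \forall z \near z0, cabs z < rho.
    apply/nearC; exists (rho - cabs z0); first by rewrite subr_gt0.
    by move=> y hy; have := cabsD (y - z0) z0; rewrite subrK; lra.
  have /nearC[d d0 dP] := near_and (near_and uE vE) (near_and cw' nr).
  pose t := d / 2.
  have t0 : 0 < t by rewrite /t; lra.
  have pt h : cabs h = t -> Re (u z0) + Re (h * v z0) + Re (h ^+ 2 * w (z0 + h))
       + e * cabs (z0 + h) ^+ 2 <= g z0 /\ `|Re (w (z0 + h) - w z0)| < e / 2.
    move=> ht; have [|[uz vz] [wz zz]] := dP (z0 + h).
      by rewrite addrC addKr ht /t; lra.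
    have gzh := gmax _ (ltW zz).
    split.
      move: gzh; rewrite /g uz vz !(addrC z0 h) !addrK.
      by rewrite mulrDr mulrA -expr2 !ReD addrA.
    by apply: le_lt_trans wz; rewrite -lecR -cabsE normc_ge_Re.
  have [] := pt t%:C; first by rewrite cabs_real gtr0_norm.
  have [] := pt (- t%:C); first by rewrite cabsN cabs_real gtr0_norm.
  have ci : cabs (t%:C * 'i%C) = t.
    rewrite cabsM cabs_real gtr0_norm// /cabs normc_def/= expr0n expr1n add0r.
    by rewrite sqrtr1 mulr1.
  have [] := pt (t%:C * 'i%C); first by [].
  have [] := pt (- (t%:C * 'i%C)); first by rewrite cabsN.
  rewrite /g !cabs_sqr; case: (u z0) => u1 u2; case: (v z0) => v1 v2.
  case: (w z0) => w1 w2; case: z0 {z0r gmax gz uE cw cw' nr dP pt vE z0r'} => x y.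
  case: (w _) => a1 a2; case: (w _) => b1 b2; case: (w _) => c1 c2.
  case: (w _) => d1 d2.
  rewrite !ltr_norml /=.
  move=> h1 /andP[k1 k1'] h2 /andP[k2 k2'] h3 /andP[k3 k3'] h4 /andP[k4 k4'].
  exfalso.
  have : 0 < t ^+ 2 * (c1 + d1 - a1 - b1 + 4 * e).
    by apply: mulr_gt0; [rewrite exprn_gt0|lra].
  move: h1 h2 h3 h4; rewrite !expr2; lra.
have : 0 <= e * cabs z ^+ 2 by rewrite mulr_ge0// ?sqr_ge0// ltW.
move: gz gz0; rewrite /g; lra.
Qed.

End maximum_principle.

(** * Power series on the unit disk *)

Section geometric_bounds.
Context {R : realType}.
Local Notation C := R[i].
Implicit Types (q : R) (c : nat -> C).

Lemma cvgC_unique (c : nat -> C) (l l' : C) :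
  c @ \oo --> l -> c @ \oo --> l' -> l = l'.
Proof. by move=> h h'; apply: (cvg_unique _ h h'); exact: norm_hausdorff. Qed.

Lemma geometric_sum_le q N : 0 <= q < 1 ->
  \sum_(0 <= k < N) q ^+ k <= (1 - q)^-1.
Proof.
move=> /andP[q0 q1]; rewrite -[leRHS]mul1r ler_pdivlMr ?subr_gt0//.
suff -> : (\sum_(0 <= k < N) q ^+ k) * (1 - q) = 1 - q ^+ N.
  by rewrite gerBl exprn_ge0.
elim: N => [|N IH]; first by rewrite big_nil mul0r subrr.
by rewrite big_nat_recr//= mulrDl IH exprS; ring.
Qed.

Lemma cvg_geometric0 c (K q : R) : 0 <= q < 1 ->
  (forall n, cabs (c n) <= K * q ^+ n) -> c @ \oo --> (0 : C).
Proof.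
move=> /andP[q0 q1] cK; apply/cvgC => e e0.
have /cvgrPdist_lt/(_ e e0) : (fun n => K * q ^+ n) @ \oo --> K * 0.
  by apply: cvgM; [exact: cvg_cst|apply: cvg_expr; rewrite ger0_norm].
apply: filterS => n; rewrite subr0 mulr0 sub0r normrN; apply: le_lt_trans.
exact: le_trans (cK n) (ler_norm _).
Qed.

(** With [q <= s ^+ 2] and [s < 1], one factor [s ^+ n] absorbs [n]. *)
Lemma natmul_geometric_le q : 0 <= q < 1 ->
  exists K s : R, 0 <= s < 1 /\ forall n, n%:R * q ^+ n <= K * s ^+ n.
Proof.
move=> /andP[q0 q1]; pose s := (1 + q) / 2.
have s1 : 0 <= s < 1 by rewrite /s; lra.
exists (1 - s)^-1, s; split=> // n; have [s0 _] := andP s1.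
have qs : q ^+ n <= s ^+ n * s ^+ n.
  have qs : q <= s * s by rewrite /s; nra.
  by rewrite -exprMn lerXn2r// nnegrE mulr_ge0.
apply: (@le_trans _ _ (n%:R * s ^+ n * s ^+ n)).
  by rewrite -mulrA ler_wpM2l.
rewrite ler_wpM2r ?exprn_ge0//; apply: le_trans (geometric_sum_le n s1).
rewrite mulr_natl -[X in _ *+ X](subn0 n) -sumr_const_nat.
apply: ler_sum_nat => k /andP[_ kn]; apply: ler_wiXn2l => //.
- by have /andP[_ /ltW] := s1.
- exact: ltnW.
Qed.

Lemma cvg_geometric_series c (K q : R) : 0 <= q < 1 ->
  (forall n, cabs (c n) <= K * q ^+ n) ->
  exists l : C, (fun N => \sum_(0 <= k < N) c k) @ \oo --> l.
Proof.
move=> /andP[q0 q1] cK.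
have real_cvg (x : nat -> R) : (forall n, `|x n| <= K * q ^+ n) -> cvgn (series x).
  move=> xK; apply: (@normed_cvg R R^o).
  apply: (@series_le_cvg _ _ (geometric K q)) => //.
  - by move=> n /=.
  - by move=> n; exact: le_trans (normr_ge0 _) (xK n).
  - by apply: is_cvg_geometric_series; rewrite ger0_norm.
have /real_cvg cr : forall n, `|Re (c n)| <= K * q ^+ n.
  by move=> n; apply: le_trans (cK n); rewrite -lecR -cabsE normc_ge_Re.
have /real_cvg ci : forall n, `|Im (c n)| <= K * q ^+ n.
  move=> n; apply: le_trans (cK n).
  rewrite -(@ler_pXn2r _ 2)// ?nnegrE ?cabs_ge0// cabs_sqr real_normK ?num_real//.
  by rewrite lerDr sqr_ge0.
exists (lim (series (fun n => Re (c n)) @ \oo) +i* lim (series (fun n => Im (c n)) @ \oo)).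
apply/cvgC => e e0; have e20 : 0 < e / 2 by lra.
move/cvgrPdist_lt/(_ _ e20): cr; move/cvgrPdist_lt/(_ _ e20): ci.
apply: filterS2 => n ni nr; apply: le_lt_trans (cabs_le _) _.
have -> : \sum_(0 <= k < n) c k = series (fun n => Re (c n)) n +i* series (fun n => Im (c n)) n.
  rewrite /series/=; elim: n {ni nr} => [|n IH]; first by rewrite !big_nil.
  by rewrite !big_nat_recr//= IH; case: (c n).
by rewrite /= [ltRHS]splitr ltrD// distrC.
Qed.

Lemma cvg_geometric_le c (K q : R) l : 0 <= K -> 0 <= q < 1 ->
  (forall n, cabs (c n) <= K * q ^+ n) ->
  (fun N => \sum_(0 <= k < N) c k) @ \oo --> l -> cabs l <= K / (1 - q).
Proof.
move=> K0 q01 cK cl; apply/ler_addgt0Pr => e e0.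
have /cvgC/(_ e e0)[N _ /(_ N (leqnn N))/=] := cl.
set S := \sum_(_ <= _ < _) _ => hS.
have := cabsD (l - S) S; rewrite subrK cabsB.
suff : cabs S <= K / (1 - q) by lra.
apply: (@le_trans _ _ (\sum_(0 <= k < N) K * q ^+ k)).
  rewrite /S; elim: (N) => [|m IH]; first by rewrite !big_nil cabs0.
  by rewrite !big_nat_recr//=; apply: le_trans (cabsD _ _) _; exact: lerD.
by rewrite -mulr_sumr ler_wpM2l ?geometric_sum_le.
Qed.

End geometric_bounds.

Section power_series.
Context {R : realType}.
Local Notation C := R[i].
Implicit Types (a b : nat -> C) (u v : C -> C) (z : C).

Definition pseries_on_disk a u := forall z, cabs z < 1 ->
  (fun N => \sum_(0 <= k < N) a k * z ^+ k) @ \oo --> u z.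

Lemma pseries_coef_bound a u (rho : R) : pseries_on_disk a u -> 0 < rho < 1 ->
  exists2 M, 0 <= M & forall n, cabs (a n) <= M * rho^-1 ^+ n.
Proof.
move=> au /andP[r0 r1].
suff [M M0 hM] : exists2 M, 0 <= M & forall n, cabs (a n) * rho ^+ n <= M.
  by exists M => // n; rewrite exprVn ler_pdivlMr ?exprn_gt0.
have /au/cvgC/(_ 1 ltr01) : cabs rho%:C < 1 by rewrite cabs_real gtr0_norm.
move=> [N _ hN]; pose t n := cabs (a n) * rho ^+ n.
have t0 n : 0 <= t n by rewrite mulr_ge0 ?cabs_ge0// exprn_ge0// ltW.
exists (2 + \sum_(0 <= k < N) t k).
  by rewrite addr_ge0// sumr_ge0.
move=> n; have [nN|Nn] := ltnP n N.
  have -> : \sum_(0 <= k < N) t k =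
      \sum_(0 <= k < n) t k + (t n + \sum_(n.+1 <= k < N) t k).
    by rewrite -big_ltn// -big_cat_nat//= ltnW.
  have : 0 <= \sum_(0 <= i < n) t i by rewrite sumr_ge0.
  have : 0 <= \sum_(n.+1 <= i < N) t i by rewrite sumr_ge0.
  rewrite -/(t n); lra.
have h1 := hN n Nn; have h2 := hN n.+1 (leqW Nn).
have : 0 <= \sum_(0 <= k < N) t k by rewrite sumr_ge0.
move: h1 h2; rewrite /= big_nat_recr//= => h1 h2.
have -> : cabs (a n) * rho ^+ n = cabs (a n * rho%:C ^+ n).
  by rewrite cabsM cabsX cabs_real gtr0_norm.
set S := \sum_(0 <= i < n) _ in h1 h2; set x := a n * _ in h2 *.
have := cabsD (S + x - u rho%:C) (u rho%:C - S).
have -> : S + x - u rho%:C + (u rho%:C - S) = x by ring.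
rewrite (cabsB (u _)); lra.
Qed.

Lemma disk_between (z z' : C) : cabs z < 1 -> cabs z' < 1 ->
  exists rho : R, [/\ 0 < rho < 1, 0 <= cabs z / rho < 1 & 0 <= cabs z' / rho < 1].
Proof.
move=> z1 z1'; have [h h'] := (cabs_ge0 z, cabs_ge0 z').
exists ((1 + Num.max (cabs z) (cabs z')) / 2).
have [le|le] := leP (cabs z) (cabs z'); have r0 : 0 < 1 + cabs z by lra.
all: have r1 : 0 < 1 + cabs z' by lra.
all: split; [lra|..]; apply/andP; split; rewrite ?divr_ge0 ?ltr_pdivrMr //; lra.
Qed.

(** With [b j] the sum of [a (j + 1 + k) * z0 ^+ k] over [k], multiplying the
    partial sums of the series of [b] by [z - z0] telescopes to those of
    [u z - u z0].  The last clause, the case [z = z0], is the differentiation of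
    the series term by term. *)
Lemma pseries_divided_difference a u z0 : pseries_on_disk a u -> cabs z0 < 1 ->
  exists b v, [/\ pseries_on_disk b v,
    forall j, b j = a j.+1 + z0 * b j.+1,
    forall z, cabs z < 1 -> u z = u z0 + (z - z0) * v z &
    (fun N => \sum_(0 <= k < N) (k%:R * a k) * z0 ^+ k) @ \oo --> z0 * v z0].
Proof.
move=> au z01.
pose shift j := fun k => a (j.+1 + k)%N * z0 ^+ k.
have shiftB (rho : R) : 0 < rho < 1 -> exists2 M, 0 <= M &
    forall j k, cabs (shift j k) <= M * rho^-1 ^+ j * (cabs z0 / rho) ^+ k.
  move=> rho1; have [M M0 aM] := pseries_coef_bound au rho1.
  have [r0 _] := andP rho1.
  exists (M / rho) => [|j k]; first by rewrite divr_ge0// ltW.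
  rewrite /shift cabsM cabsX exprMn mulrCA.
  rewrite [leLHS]mulrC ler_wpM2l ?exprn_ge0 ?cabs_ge0//.
  by apply: le_trans (aM _) _; rewrite exprD exprS !mulrA.
have /choice[b bE] j : exists l : C,
    (fun N => \sum_(0 <= k < N) shift j k) @ \oo --> l.
  have [rho [rho1 qz _]] := disk_between z01 z01.
  have [M M0 sM] := shiftB _ rho1.
  exact: (cvg_geometric_series qz (sM j)).
have bB (rho : R) : 0 < rho < 1 -> 0 <= cabs z0 / rho < 1 -> exists2 K, 0 <= K &
    forall j, cabs (b j) <= K * rho^-1 ^+ j.
  move=> rho1 qz; have [M M0 sM] := shiftB _ rho1.
  have [[r0 _] [q0 q1]] := (andP rho1, andP qz).
  exists (M / (1 - cabs z0 / rho)) => [|j].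
    by rewrite divr_ge0// subr_ge0 ltW.
  rewrite mulrAC; apply: (cvg_geometric_le _ qz (sM j) (bE j)).
  by rewrite mulr_ge0// exprn_ge0// invr_ge0 ltW.
have bS j : b j = a j.+1 + z0 * b j.+1.
  apply: (@cvgC_unique _ (fun N => \sum_(0 <= k < N.+1) shift j k)).
    by have := bE j; rewrite -(cvg_shiftS (fun N => \sum_(0 <= k < N) shift j k)).
  have -> : (fun N => \sum_(0 <= k < N.+1) shift j k) =
            (fun N => a j.+1 + z0 * \sum_(0 <= k < N) shift j.+1 k).
    apply/funext => N; rewrite big_nat_recl//= /shift addn0 expr0 mulr1 mulr_sumr.
    by congr (_ + _); apply: eq_bigr => k _; rewrite addnS !addSn exprS mulrCA.
  by apply: cvgD; [exact: cvg_cst|apply: cvgM; [exact: cvg_cst|exact: bE]].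
have u0 : u z0 = a 0%N + z0 * b 0%N.
  apply: (@cvgC_unique _ (fun N => \sum_(0 <= k < N.+1) a k * z0 ^+ k)).
    by have := au _ z01; rewrite -(cvg_shiftS (fun N => \sum_(0 <= k < N) _)).
  have -> : (fun N => \sum_(0 <= k < N.+1) a k * z0 ^+ k) =
            (fun N => a 0%N + z0 * \sum_(0 <= k < N) shift 0 k).
    apply/funext => N; rewrite big_nat_recl//= expr0 mulr1 mulr_sumr.
    by congr (_ + _); apply: eq_bigr => k _; rewrite /shift add1n exprS mulrCA.
  by apply: cvgD; [exact: cvg_cst|apply: cvgM; [exact: cvg_cst|exact: bE]].
have /choice[v vE] z : exists l : C, cabs z < 1 ->
    (fun N => \sum_(0 <= k < N) b k * z ^+ k) @ \oo --> l.
  have [z1|z1] := ltP (cabs z) 1; last by exists 0.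
  have [rho [rho1 qz0 qz]] := disk_between z01 z1.
  have [K K0 bK] := bB _ rho1 qz0.
  have [|l hl] := @cvg_geometric_series _ (fun k => b k * z ^+ k) K _ qz.
    move=> n; rewrite cabsM cabsX exprMn mulrCA [leLHS]mulrC.
    by rewrite ler_wpM2l ?exprn_ge0 ?cabs_ge0.
  by exists l.
exists b, v; split=> //.
  move=> z z1; have [rho [rho1 qz0 qz]] := disk_between z01 z1.
  have [K K0 bK] := bB _ rho1 qz0.
  suff : (z - z0) * v z = u z - u z0 + z * 0 by move=> ->; ring.
  apply: (@cvgC_unique _ (fun N => (z - z0) * \sum_(0 <= k < N.+1) b k * z ^+ k)).
    apply: cvgM; first exact: cvg_cst.
    by have := vE _ z1; rewrite -(cvg_shiftS (fun N => \sum_(0 <= k < N) _)).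
  have -> : (fun N => (z - z0) * \sum_(0 <= k < N.+1) b k * z ^+ k) =
    (fun N => \sum_(0 <= k < N.+1) a k * z ^+ k - u z0 + z * (b N * z ^+ N)).
    apply/funext; elim=> [|N IH].
      by rewrite !big_nat1 !expr0 u0; ring.
    by rewrite big_nat_recr//= mulrDr IH [in RHS]big_nat_recr//= bS !exprS; ring.
  apply: cvgD.
    apply: cvgB; last exact: cvg_cst.
    by have := au _ z1; rewrite -(cvg_shiftS (fun N => \sum_(0 <= k < N) _)).
  apply: cvgM; first exact: cvg_cst.
  apply: (cvg_geometric0 qz (K := K)) => n.
  by rewrite cabsM cabsX exprMn mulrCA [leLHS]mulrC ler_wpM2l ?exprn_ge0 ?cabs_ge0.
have [rho [rho1 qz _]] := disk_between z01 z01.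
have [K K0 bK] := bB _ rho1 qz.
have -> : z0 * v z0 = z0 * v z0 - z0 * 0 by ring.
rewrite -(cvg_shiftS (fun N => \sum_(0 <= k < N) _)).
have -> : (fun N => \sum_(0 <= k < N.+1) (k%:R * a k) * z0 ^+ k) =
   (fun N => z0 * (\sum_(0 <= k < N) b k * z0 ^+ k) - z0 * (N%:R * (b N * z0 ^+ N))).
  apply/funext; elim=> [|N IH].
    by rewrite big_nat1 big_nil; ring.
  rewrite big_nat_recr//= IH [in RHS]big_nat_recr//= bS !exprS -natr1; ring.
apply: cvgB; apply: cvgM; try exact: cvg_cst; first exact: vE.
have [L [s [s1 hL]]] := natmul_geometric_le qz.
apply: (cvg_geometric0 s1 (K := K * L)) => n.
have -> : cabs (n%:R * (b n * z0 ^+ n)) = n%:R * (cabs (b n) * cabs z0 ^+ n).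
  by rewrite !cabsM cabsX -(rmorph_nat (real_complex R)) cabs_real ger0_norm.
rewrite -mulrA; apply: le_trans (ler_wpM2l K0 (hL n)).
rewrite [leRHS]mulrCA ler_wpM2l//.
by rewrite exprMn mulrCA [leLHS]mulrC ler_wpM2l ?exprn_ge0 ?cabs_ge0.
Qed.

(** The coefficient bound at one radius between [cabs z0] and [1] dominates the
    series by a geometric one, uniformly near [z0]. *)
Lemma pseries_locally_bounded a u z0 : pseries_on_disk a u -> cabs z0 < 1 ->
  exists2 M, 0 <= M & \forall z \near z0, cabs (u z) <= M.
Proof.
move=> au z01; have [rho [rho1 /andP[q0 q1] _]] := disk_between z01 z01.
have [M M0 aM] := pseries_coef_bound au rho1; have [r0 r1] := andP rho1.
pose s := (cabs z0 + rho) / 2; have h0 := cabs_ge0 z0.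
move: q1; rewrite ltr_pdivrMr// mul1r => q1.
have s1 : 0 <= s / rho < 1.
  by rewrite divr_ge0 ?ltr_pdivrMr //= /s; lra.
exists (M / (1 - s / rho)).
  by rewrite divr_ge0// subr_ge0 ltW//; case/andP: s1.
apply/nearC; exists (s - cabs z0); first by rewrite /s; lra.
move=> z hz; have zs : cabs z <= s by have := cabsD (z - z0) z0; rewrite subrK; lra.
have z1 : cabs z < 1 by apply: le_lt_trans zs _; rewrite /s; lra.
apply: (cvg_geometric_le M0 s1 _ (au z z1)) => n.
rewrite cabsM cabsX exprMn mulrCA mulrC.
apply: ler_pM => //; rewrite ?cabs_ge0 ?exprn_ge0 ?cabs_ge0//.
by rewrite lerXn2r ?nnegrE ?cabs_ge0// (le_trans (cabs_ge0 z)).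
Qed.

Definition disk_smooth u := forall z, cabs z < 1 -> forall n, smooth n u z.

(** The divided difference of a power series is a power series, which is bounded
    near [z0]: this gives continuity, and then induction on the order. *)
Lemma pseries_disk_smooth a u : pseries_on_disk a u -> disk_smooth u.
Proof.
move=> au z0 z01 n; elim: n a u au => [|n IH] a u au.
all: have [b [v [bv _ uE _]]] := pseries_divided_difference au z01.
  have [M M0 vM] := pseries_locally_bounded bv z01.
  apply/continuousC => e e0.
  have M1 : 0 < M + 1 by lra.
  have dz : \forall z \near z0, cabs (z - z0) < e / (M + 1).
    by apply/nearC; exists (e / (M + 1)) => //; rewrite divr_gt0.
  apply: filterS2 (near_and vM dz) (disk_open z01) => z [vz zz] z1.
  rewrite uE// addrC addKr cabsM; move: zz; rewrite ltr_pdivlMr//.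
  have := cabs_ge0 (z - z0); nra.
exists v; first exact: IH bv.
by have := disk_open z01; apply: filterS => z; exact: uE.
Qed.

End power_series.

(** * Taylor coefficients on the unit disk *)

Section taylor.
Context {R : realType}.
Local Notation C := R[i].
Implicit Types (u v w P : C -> C) (z c : C) (n : nat).

Lemma cabs0_lt1 : cabs (0 : C) < 1.
Proof. by rewrite cabs0. Qed.

Lemma disk_smooth_eq u v : (forall z, cabs z < 1 -> u z = v z) -> disk_smooth v -> disk_smooth u.
Proof.
move=> uv hv z z1 n; apply: smooth_near (hv z z1 n).
by have := disk_open z1; apply: filterS; exact: uv.
Qed.

Lemma disk_smooth_cst c : disk_smooth (fun=> c).
Proof. by move=> z z1 n; exact: smooth_cst. Qed.

Lemma disk_smooth_id : disk_smooth (@id C).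
Proof. by move=> z z1 n; exact: smooth_id. Qed.

Lemma disk_smoothD u v : disk_smooth u -> disk_smooth v -> disk_smooth (fun z => u z + v z).
Proof. by move=> hu hv z z1 n; apply: smoothD; [exact: hu|exact: hv]. Qed.

Lemma disk_smoothM u v : disk_smooth u -> disk_smooth v -> disk_smooth (fun z => u z * v z).
Proof. by move=> hu hv z z1 n; apply: smoothM; [exact: hu|exact: hv]. Qed.

Lemma disk_smoothB u v : disk_smooth u -> disk_smooth v -> disk_smooth (fun z => u z - v z).
Proof. by move=> hu hv z z1 n; apply: smoothB; [exact: hu|exact: hv]. Qed.

Lemma disk_smoothX n : disk_smooth (fun z : C => z ^+ n).
Proof.
elim: n => [|n IH]; first exact: disk_smooth_cst.
by apply: disk_smooth_eq (disk_smoothM disk_smooth_id IH) => z _; rewrite exprS.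
Qed.

Lemma disk_smoothV u : (forall z, cabs z < 1 -> u z != 0) -> disk_smooth u ->
  disk_smooth (fun z => (u z)^-1).
Proof. by move=> u0 hu z z1 n; apply: smoothV; [exact: u0|exact: hu]. Qed.

Lemma disk_smooth_comp u v : (forall z, cabs z < 1 -> cabs (u z) < 1) ->
  disk_smooth u -> disk_smooth v -> disk_smooth (fun z => v (u z)).
Proof.
by move=> u1 hu hv z z1 n; apply: smooth_comp; [exact: hu|apply: hv; exact: u1].
Qed.

Lemma disk_smooth_sum (I : Type) (r : seq I) (u : I -> C -> C) :
  (forall i, disk_smooth (u i)) -> disk_smooth (fun z => \sum_(i <- r) u i z).
Proof.
move=> hu; elim: r => [|i r IH].
  by apply: disk_smooth_eq (disk_smooth_cst 0) => z _; rewrite big_nil.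
by apply: disk_smooth_eq (disk_smoothD (hu i) IH) => z _; rewrite big_cons.
Qed.

Lemma punctured_eq u v z0 : {for z0, continuous u} -> {for z0, continuous v} ->
  (\forall z \near z0, z != z0 -> u z = v z) -> u z0 = v z0.
Proof.
move=> /continuousC cu /continuousC cv uv; apply/eqP; apply: contraT => ne.
have e0 : 0 < cabs (u z0 - v z0) / 2 by rewrite divr_gt0// cabs_gt0 subr_eq0.
have /nearC[d d0 dP] := near_and (near_and (cu _ e0) (cv _ e0)) uv.
pose y := z0 + (d / 2)%:C; have yz0 : y - z0 = (d / 2)%:C by rewrite /y addrC addKr.
have [|[h1 h2] h3] := dP y; first by rewrite yz0 cabs_real ger0_norm; lra.
have uvE : u y = v y.
  by apply: h3; rewrite -subr_eq0 yz0 -cabs_gt0 cabs_real gtr0_norm; lra.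
move: h1; rewrite uvE cabsB => h1.
have := cabsD (u z0 - v y) (v y - v z0).
rewrite addrA subrK; lra.
Qed.

(** Off [0] the quotient is a quotient of smooth functions.  At [0], whatever the
    order of the expansion of [u], the divided difference given by that
    expansion has the same value, the limit of the quotient. *)
Lemma disk_smooth_divided_difference u : disk_smooth u ->
  exists v, disk_smooth v /\ forall z, cabs z < 1 -> u z = u 0 + z * v z.
Proof.
move=> hu; have [v0 cv0 v0E] := hu 0 cabs0_lt1 1%N.
pose v z := if z == 0 then v0 0 else (u z - u 0) / z.
exists v; split; last first.
  move=> z z1; rewrite /v; case: eqVneq => [->|z0]; first by rewrite mul0r addr0.
  by rewrite mulrC divfK// subrKC.
move=> z z1 n; have [->|z0] := eqVneq z 0; last first.
  apply: (@smooth_near _ _ _ (fun y => (u y - u 0) * y^-1)).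
    have := near_neq0 (@continuous_id _ z) z0.
    by apply: filterS => y y0; rewrite /v (negPf y0).
  apply: smoothM; last by apply: smoothV => //; exact: smooth_id.
  by apply: smoothB; [exact: hu|exact: smooth_cst].
have [w sw wE] := hu 0 cabs0_lt1 n.+1.
apply: (smooth_near _ sw).
(* Both are the limit of the quotient at [0]. *)
have wv0 : w 0 = v0 0.
  apply: punctured_eq cv0 _; first exact: smooth_continuous sw.
  apply: filterS2 wE v0E => y -> /addrI; rewrite subr0 => yE y0.
  exact: (mulfI y0).
apply: filterS wE => y yE; rewrite /v; case: eqVneq => [->//|y0].
by rewrite yE addrC addKr subr0 mulrC mulKf.
Qed.

(** The divided difference of [u] at [0].  Only its values on the disk are
    meaningful; there it is unique ([div0_unique]). *)
Definition div0 u : C -> C := xget (fun=> 0)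
  [set v | disk_smooth v /\ forall z, cabs z < 1 -> u z = u 0 + z * v z].

Lemma div0P u : disk_smooth u ->
  disk_smooth (div0 u) /\ forall z, cabs z < 1 -> u z = u 0 + z * div0 u z.
Proof.
move=> /disk_smooth_divided_difference[v hv]; rewrite /div0.
by case: xgetP => [w _ //|/(_ v)].
Qed.

Lemma disk_smooth_div0 u : disk_smooth u -> disk_smooth (div0 u).
Proof. by move=> /div0P[]. Qed.

Lemma div0E u : disk_smooth u -> forall z, cabs z < 1 -> u z = u 0 + z * div0 u z.
Proof. by move=> /div0P[]. Qed.

Lemma div0_unique u v c : disk_smooth v ->
  (forall z, cabs z < 1 -> u z = c + z * v z) ->
  forall z, cabs z < 1 -> div0 u z = v z.
Proof.
move=> hv uE.
have u0 : u 0 = c by rewrite uE ?cabs0// mul0r addr0.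
have hu : disk_smooth u.
  by apply: disk_smooth_eq uE _; apply: disk_smoothD; [exact: disk_smooth_cst|apply: disk_smoothM => //; exact: disk_smooth_id].
have eqn0 z : cabs z < 1 -> z != 0 -> div0 u z = v z.
  move=> z1 z0; apply: (mulfI z0); apply: (@addrI _ c).
  by rewrite -[in LHS]u0 -div0E// uE.
move=> z z1; have [->|] := eqVneq z 0; last exact: eqn0.
apply: punctured_eq; [exact: (disk_smooth_div0 hu cabs0_lt1 0)|exact: (hv _ cabs0_lt1 0)|].
by have := disk_open cabs0_lt1; apply: filterS => y; exact: eqn0.
Qed.

(** The [n]-th Taylor coefficient of [u] at [0].  Iterating [div0] turns
    identities between functions into recursions for coefficients, by
    [coef_cons]. *)
Definition coef u n : C := iter n div0 u 0.

Lemma disk_smooth_iter_div0 u n : disk_smooth u -> disk_smooth (iter n div0 u).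
Proof. by move=> hu; elim: n => //= n; exact: disk_smooth_div0. Qed.

Lemma coef0 u : coef u 0 = u 0. Proof. by []. Qed.

Lemma coefS u n : coef u n.+1 = coef (div0 u) n.
Proof. by rewrite /coef iterSr. Qed.

Lemma eq_coef u v n : disk_smooth v -> (forall z, cabs z < 1 -> u z = v z) ->
  coef u n = coef v n.
Proof.
elim: n u v => [|n IH] u v hv uv; first by rewrite /coef/= uv ?cabs0.
rewrite !coefS; apply: IH; first exact: disk_smooth_div0.
by apply: (@div0_unique _ _ (v 0)); [exact: disk_smooth_div0|move=> z z1; rewrite uv// div0E].
Qed.

Lemma coef_cons u v c n : disk_smooth v ->
  (forall z, cabs z < 1 -> u z = c + z * v z) -> coef u n.+1 = coef v n.
Proof. by move=> hv uE; rewrite coefS; apply: eq_coef => //; exact: div0_unique uE. Qed.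

Lemma coef_pseries a u n : pseries_on_disk a u -> coef u n = a n.
Proof.
elim: n a u => [|n IH] a u au.
  apply: (cvgC_unique (au 0 cabs0_lt1)); apply/cvgC => e e0.
  exists 1%N => // -[//|N] _ /=; suff -> : \sum_(0 <= k < N.+1) a k * 0 ^+ k = a 0%N.
    by rewrite subrr cabs0.
  rewrite big_nat_recl//= expr0 mulr1 big1 ?addr0// => k _.
  by rewrite exprS mul0r mulr0.
have [b [v [bv bS uE _]]] := pseries_divided_difference au cabs0_lt1.
have uE' z : cabs z < 1 -> u z = u 0 + z * v z by move=> /uE ->; rewrite subr0.
by rewrite (coef_cons n (pseries_disk_smooth bv) uE') (IH _ _ bv) bS mul0r addr0.
Qed.

Lemma taylor u n : disk_smooth u -> forall z, cabs z < 1 ->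
  u z = \sum_(k < n) coef u k * z ^+ k + z ^+ n * iter n div0 u z.
Proof.
move=> hu z z1; elim: n => [|n IH]; first by rewrite big_ord0 expr0 mul1r add0r.
rewrite IH (div0E (disk_smooth_iter_div0 n hu) z1) -/(coef u n) big_ord_recr/= exprS.
by ring.
Qed.

Lemma coefD u v n : disk_smooth u -> disk_smooth v ->
  coef (fun z => u z + v z) n = coef u n + coef v n.
Proof.
elim: n u v => [//|n IH] u v hu hv; have [hu1 hv1] := (disk_smooth_div0 hu, disk_smooth_div0 hv).
rewrite (coef_cons (v := fun z => div0 u z + div0 v z) (c := u 0 + v 0)).
- by rewrite IH// !coefS.
- exact: disk_smoothD.
- by move=> z z1; rewrite (div0E hu z1) (div0E hv z1); ring.
Qed.

Lemma coef_cst c n : coef (fun=> c) n = if n is 0 then c else 0.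
Proof.
elim: n c => [//|n IH] c; rewrite (coef_cons (v := fun=> 0) (c := c)).
- by rewrite IH; case: n {IH}.
- exact: disk_smooth_cst.
- by move=> z _; rewrite mulr0 addr0.
Qed.

Lemma coefZ u c n : disk_smooth u -> coef (fun z => c * u z) n = c * coef u n.
Proof.
elim: n u => [//|n IH] u hu; have hu1 := disk_smooth_div0 hu.
rewrite (coef_cons (v := fun z => c * div0 u z) (c := c * u 0)).
- by rewrite IH// !coefS.
- by apply: disk_smoothM => //; exact: disk_smooth_cst.
- by move=> z z1; rewrite (div0E hu z1); ring.
Qed.

(** The Cauchy product, from the Leibniz rule for [div0]. *)
Lemma coefM u v n : disk_smooth u -> disk_smooth v ->
  coef (fun z => u z * v z) n = \sum_(i < n.+1) coef u i * coef v (n - i)%N.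
Proof.
elim: n u v => [|n IH] u v hu hv; first by rewrite big_ord1.
have [hu1 hv1] := (disk_smooth_div0 hu, disk_smooth_div0 hv).
have h1 := disk_smoothM hu1 hv; have h2 := disk_smoothM (disk_smooth_cst (u 0)) hv1.
rewrite (coef_cons (v := fun z => div0 u z * v z + u 0 * div0 v z) (c := u 0 * v 0)).
- rewrite coefD// IH// coefZ// [in RHS]big_ord_recl subn0 addrC -coefS.
  by congr (_ + _); apply: eq_bigr => i _; rewrite -coefS.
- exact: disk_smoothD.
- by move=> z z1; rewrite (div0E hu z1) (div0E hv z1); ring.
Qed.

End taylor.

(** * The inequalities of Schwarz and Caratheodory *)

Section schwarz.
Context {R : realType}.
Local Notation C := R[i].
Implicit Types (u v P : C -> C) (z c : C) (n : nat).

Lemma cabs_rotate (c : C) : exists2 l : C, cabs l = 1 & l * c = (cabs c)%:C.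
Proof.
have [->|c0] := eqVneq c 0; first by exists 1; rewrite ?cabs1// mulr0 cabs0.
have c0' : (cabs c)%:C != 0.
  by rewrite (inj_eq (@complexI R)) cabs_eq0.
exists (c^* / (cabs c)%:C).
  rewrite cabsM cabsV cabs_real ger0_norm ?cabs_ge0//.
  have -> : cabs c^* = cabs c by rewrite /cabs normcJ.
  by rewrite divff// cabs_eq0.
by rewrite mulrAC conj_mul_cabs expr2 rmorphM/= mulfK.
Qed.

(** A rotation turns the modulus at the given point into a real part. *)
Lemma maximum_cabs u (rho M : R) : 0 <= rho < 1 -> disk_smooth u ->
  (forall z, cabs z = rho -> cabs (u z) <= M) ->
  forall z, cabs z <= rho -> cabs (u z) <= M.
Proof.
move=> rho1 hu uM z zr; have [l l1 lE] := cabs_rotate (u z).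
have -> : cabs (u z) = Re (l * u z) by rewrite lE.
apply: (@maximum_Re _ (fun y => l * u y) rho) zr => // y y1.
  by apply: smoothM; [exact: smooth_cst|exact: hu].
by apply: le_trans (Re_le_cabs _) _; rewrite cabsM l1 mul1r uM.
Qed.

(** Schwarz's lemma: on the circle of radius [rho] the hypothesis bounds [u] by
    [rho^-1], and [rho] tends to [1]. *)
Lemma schwarz u : disk_smooth u -> (forall z, cabs z < 1 -> cabs (z * u z) <= 1) ->
  forall z, cabs z < 1 -> cabs (u z) <= 1.
Proof.
move=> hu u1 z z1; rewrite leNgt; apply/negP => uz1.
(* A radius with [cabs z < rho] and [rho^-1 < cabs (u z)]. *)
pose m := Num.max (cabs z) (cabs (u z))^-1; pose rho := (1 + m) / 2.
have m1 : m < 1 by rewrite gt_max z1 invf_lt1 ?(lt_trans ltr01).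
have zm : cabs z <= m by rewrite le_max lexx.
have um : (cabs (u z))^-1 <= m by rewrite le_max lexx orbT.
have z0 := cabs_ge0 z; have rho1 : 0 < rho < 1 by rewrite /rho; lra.
have [r0 r1] := andP rho1.
have : cabs (u z) <= rho^-1.
  apply: (maximum_cabs (rho := rho)) => //; first by rewrite ltW.
  - move=> y yr; have := u1 y; rewrite yr cabsM yr => /(_ r1).
    by rewrite -[rho^-1]mul1r ler_pdivlMr// mulrC.
  - by rewrite /rho; lra.
rewrite leNgt; apply/negP; rewrite negbK invf_plt ?posrE//; last by lra.
by rewrite /rho; lra.
Qed.

Lemma schwarz_iter u n : disk_smooth u ->
  (forall z, cabs z < 1 -> cabs (z ^+ n * u z) <= 1) ->
  forall z, cabs z < 1 -> cabs (u z) <= 1.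
Proof.
elim: n u => [|n IH] u hu u1; first by move=> z /u1; rewrite expr0 mul1r.
apply: IH => //; apply: schwarz; first by apply: disk_smoothM => //; exact: disk_smoothX.
by move=> z /u1; rewrite exprS mulrA.
Qed.

(** ['X^n - 1] is separable and splits over the algebraically closed field
    [R[i]]. *)
Lemma prim_root_complex n : (0 < n)%N -> exists w : C, n.-primitive_root w.
Proof.
move=> n0; have [r rE] := closed_field_poly_normal ('X^n - 1 : {poly C}).
move: rE; rewrite (monicP (monicXnsubC _ n0)) scale1r => rE.
have ru : all n.-unity_root r.
  by apply/allP => w; rewrite -root_prod_XsubC -rE.
have sz : (n < (size r).+1)%N.
  by rewrite -(size_prod_XsubC r id) -rE size_XnsubC.
have un : uniq r.
  by rewrite -separable_prod_XsubC -rE separable_Xn_sub_1// pnatr_eq0 -lt0n.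
by have /hasP[w _ hw] := cyclic.has_prim_root n0 ru un sz; exists w.
Qed.

Lemma cabs_prim_root (w : C) n : n.-primitive_root w -> cabs w = 1.
Proof.
move=> pw; have n0 := prim_order_gt0 pw; apply/eqP.
by rewrite -(@pexpr_eq1 _ _ n)// ?cabs_ge0// -cabsX (prim_expr_order pw) cabs1.
Qed.

Lemma cabs_subr_le_addr (r : C) (x : R) : 0 <= Re r -> 0 <= x ->
  cabs (r - x%:C) <= cabs (r + x%:C).
Proof.
move=> r0 x0; rewrite -(@ler_pXn2r _ 2)// ?nnegrE ?cabs_ge0// !cabs_sqr.
by case: r r0 => a b /= a0; rewrite oppr0 addr0 lerD2r; nra.
Qed.

(** The average [A P] of [P] over the rotations by [n]-th roots of unity keeps
    the sign of the real part and only the coefficients of index divisible by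
    [n]: it equals [x + z ^+ n * A S z], where [S 0] is the [n]-th coefficient
    of [P].  The Cayley transform [(A P - x) / (A P + x)] is bounded by [1] and
    has a zero of order [n] at [0], so that Schwarz's lemma bounds
    [S 0 / (2 * x)] by [1]. *)
Lemma caratheodory_pos P (x : R) n : disk_smooth P ->
  (forall z, cabs z < 1 -> 0 <= Re (P z)) -> P 0 = x%:C -> 0 < x -> (0 < n)%N ->
  cabs (coef P n) <= 2 * x.
Proof.
move=> hP Re0 P0 x0 n0; have [w pw] := prim_root_complex n0.
have nC : (n%:R : C) != 0 by rewrite pnatr_eq0 -lt0n.
have wz k z : cabs z < 1 -> cabs (w ^+ k * z) < 1.
  by rewrite cabsM cabsX (cabs_prim_root pw) expr1n mul1r.
have Hw k u : disk_smooth u -> disk_smooth (fun z => u (w ^+ k * z)).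
  move=> hu; apply: disk_smooth_comp hu => //; first exact: wz.
  by apply: disk_smoothM; [exact: disk_smooth_cst|exact: disk_smooth_id].
pose S := iter n div0 P; have hS : disk_smooth S by apply: disk_smooth_iter_div0.
pose A u z : C := n%:R^-1 * \sum_(j < n) u (w ^+ j * z).
have HA u : disk_smooth u -> disk_smooth (A u).
  move=> hu; apply: disk_smoothM; first exact: disk_smooth_cst.
  by apply: (@disk_smooth_sum _ _ _ (fun j z => u (w ^+ (j : 'I_n) * z))) => j; exact: Hw.
have avg z : cabs z < 1 -> A P z = x%:C + z ^+ n * A S z.
  move=> z1; rewrite /A.
  have -> : \sum_(j < n) P (w ^+ j * z) =
      \sum_(k < n) coef P k * z ^+ k * (\sum_(j < n) (w ^+ k) ^+ j) +
      z ^+ n * \sum_(j < n) S (w ^+ j * z).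
    rewrite mulr_sumr.
    under [X in _ = X + _]eq_bigr do rewrite mulr_sumr.
    rewrite exchange_big -big_split/=; apply: eq_bigr => j _.
    rewrite (taylor n hP (wz j z z1)) -/S exprMn -exprM mulnC exprM.
    rewrite (prim_expr_order pw) expr1n mul1r; congr (_ + _).
    by apply: eq_bigr => k _; rewrite exprMn -!exprM mulnC [w ^+ _ * _]mulrC mulrA.
  rewrite mulrDr mulrCA; congr (_ + _).
  rewrite (bigD1 (Ordinal n0))//= [X in _ + X]big1 ?addr0 => [|k k0].
    rewrite expr0 mulr1 coef0 P0.
    under eq_bigr do rewrite expr1n.
    by rewrite sumr_const card_ord mulrCA mulVf// mulr1.
  suff -> : \sum_(j < n) (w ^+ k) ^+ j = 0 by rewrite mulr0.
  have wk1 : w ^+ k - 1 != 0.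
    rewrite subr_eq0 -(prim_order_dvd pw) gtnNdvd// lt0n.
    by apply: contra k0 => /eqP k0; apply/eqP/val_inj.
  apply: (mulfI wk1); rewrite mulr0 -subrX1 -exprM mulnC exprM.
  by rewrite (prim_expr_order pw) expr1n subrr.
have AP0 z : cabs z < 1 -> 0 <= Re (A P z).
  move=> z1; rewrite /A -(rmorph_nat (real_complex R)) -fmorphV ReZ mulr_ge0//.
  elim/big_ind: _ => // [a b a0 b0|j _]; first by rewrite ReD addr_ge0.
  exact/Re0/wz.
have den z : cabs z < 1 -> A P z + x%:C != 0.
  move=> /AP0 h; apply/eqP => /(congr1 (fun t => Re t)); rewrite ReD/=; lra.
pose V z := A S z / (A P z + x%:C).
have hV : disk_smooth V.
  apply: disk_smoothM; first exact: HA.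
  by apply: disk_smoothV den _; apply: disk_smoothD; [exact: HA|exact: disk_smooth_cst].
have V1 : cabs (V 0) <= 1.
  apply: (schwarz_iter (n := n)) => //; last exact: cabs0_lt1.
  move=> z z1; rewrite /V mulrA cabsM cabsV.
  rewrite ler_pdivrMr ?mul1r ?cabs_gt0 ?den//.
  have -> : z ^+ n * A S z = A P z - x%:C by rewrite avg// addrC addKr.
  by apply: cabs_subr_le_addr; [exact: AP0|exact: ltW].
have A0 u : A u 0 = u 0.
  rewrite /A; under eq_bigr do rewrite mulr0.
  by rewrite sumr_const card_ord -[u 0 *+ n]mulr_natl mulKf.
move: V1; rewrite /V !A0 P0 cabsM cabsV -rmorphD/= cabs_real gtr0_norm; last by lra.
by rewrite ler_pdivrMr ?mul1r -/(coef P n); lra.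
Qed.

(** The case of a vanishing [P 0] is a limit of the previous one. *)
Lemma caratheodory P (x : R) n : disk_smooth P ->
  (forall z, cabs z < 1 -> 0 <= Re (P z)) -> P 0 = x%:C -> (0 < n)%N ->
  cabs (coef P n) <= 2 * x.
Proof.
move=> hP Re0 P0 n0; have x0 : 0 <= x by have := Re0 0 cabs0_lt1; rewrite P0.
apply/ler_addgt0Pr => e e0; have e2 : 0 < e / 2 by lra.
have hPe : disk_smooth (fun z => (e / 2)%:C + P z).
  by apply: disk_smoothD => //; exact: disk_smooth_cst.
have := @caratheodory_pos _ (e / 2 + x) n hPe.
rewrite coefD ?coef_cst//; last exact: disk_smooth_cst.
case: n n0 => // n _; rewrite add0r => h.
have : cabs (coef P n.+1) <= 2 * (e / 2 + x).
  apply: h => //; last by lra.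
  - by move=> z z1; rewrite ReD /= addr_ge0 ?Re0//; lra.
  - by rewrite P0 -rmorphD.
lra.
Qed.

End schwarz.

(** * Majorant series, and the coefficients of starlike functions *)

Section bohr.
Context {R : realType}.
Local Notation C := R[i].
Implicit Types (u v psi : C -> C) (z c : C) (n K : nat).

Definition majorant u (r : R) K : R := \sum_(k < K) cabs (coef u k) * r ^+ k.

Lemma majorant_ge0 u r K : 0 <= r -> 0 <= majorant u r K.
Proof. by move=> r0; apply: sumr_ge0 => k _; rewrite mulr_ge0 ?cabs_ge0 ?exprn_ge0. Qed.

Lemma majorantS u r K :
  majorant u r K.+1 = cabs (u 0) + r * majorant (div0 u) r K.
Proof.
rewrite /majorant big_ord_recl/= expr0 mulr1 mulr_sumr; congr (_ + _).
by apply: eq_bigr => k _; rewrite coefS exprS mulrCA.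
Qed.

Lemma majorant_leS u r K : 0 <= r -> majorant u r K <= majorant u r K.+1.
Proof.
by move=> r0; rewrite /majorant big_ord_recr/= lerDl mulr_ge0 ?cabs_ge0 ?exprn_ge0.
Qed.

Lemma eq_majorant u v r K : disk_smooth v -> (forall z, cabs z < 1 -> u z = v z) ->
  majorant u r K = majorant v r K.
Proof. by move=> hv uv; apply: eq_bigr => k _; rewrite (eq_coef k hv uv). Qed.

Lemma majorant_cons u v c r K : disk_smooth v ->
  (forall z, cabs z < 1 -> u z = c + z * v z) ->
  majorant u r K.+1 = cabs c + r * majorant v r K.
Proof.
move=> hv uE; rewrite majorantS uE ?cabs0// mul0r addr0.
by rewrite (eq_majorant _ _ hv (div0_unique hv uE)).
Qed.

Lemma majorantD u v r K : 0 <= r -> disk_smooth u -> disk_smooth v ->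
  majorant (fun z => u z + v z) r K <= majorant u r K + majorant v r K.
Proof.
move=> r0 hu hv; rewrite /majorant -big_split; apply: ler_sum => k _ /=.
by rewrite -mulrDl ler_wpM2r ?exprn_ge0// coefD// cabsD.
Qed.

Lemma majorantZ u c r K : disk_smooth u ->
  majorant (fun z => c * u z) r K = cabs c * majorant u r K.
Proof.
move=> hu; rewrite /majorant mulr_sumr; apply: eq_bigr => k _.
by rewrite coefZ// cabsM mulrA.
Qed.

(** Splitting off the constant coefficients of both factors reduces the order
    by one. *)
Lemma majorantM u v r K : 0 <= r -> disk_smooth u -> disk_smooth v ->
  majorant (fun z => u z * v z) r K <= majorant u r K * majorant v r K.
Proof.
move=> r0; elim: K u v => [|K IH] u v hu hv.
  by rewrite /majorant !big_ord0 mulr0.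
have [hu1 hv1] := (disk_smooth_div0 hu, disk_smooth_div0 hv).
have h1 := disk_smoothM hu1 hv; have h2 := disk_smoothM (disk_smooth_cst (u 0)) hv1.
rewrite (@majorant_cons _ (fun z => div0 u z * v z + u 0 * div0 v z) (u 0 * v 0));
  [|exact: disk_smoothD|by move=> z z1; rewrite (div0E hu z1) (div0E hv z1); ring].
have b1 := IH _ _ hu1 hv; have b2 := majorantD K r0 h1 h2.
rewrite (majorantZ _ _ _ hv1) in b2.
have b3 : majorant (div0 u) r K * majorant v r K <=
          majorant (div0 u) r K * majorant v r K.+1.
  by rewrite ler_wpM2l ?majorant_ge0// majorant_leS.
have -> : majorant u r K.+1 * majorant v r K.+1 = cabs (u 0) * cabs (v 0) +
    r * (cabs (u 0) * majorant (div0 v) r K + majorant (div0 u) r K * majorant v r K.+1).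
  by rewrite (majorantS u) mulrDl {1}(majorantS v); ring.
rewrite cabsM lerD2l ler_wpM2l//; lra.
Qed.

(** Bohr's theorem, from Caratheodory's inequality for [1 - l * psi], where the
    unimodular [l] makes [l * psi 0] nonnegative: the coefficients of positive
    index are at most [2 * (1 - cabs (psi 0))]. *)
Lemma bohr psi r K : disk_smooth psi -> (forall z, cabs z < 1 -> cabs (psi z) <= 1) ->
  0 <= r -> 3 * r <= 1 -> majorant psi r K <= 1.
Proof.
move=> hpsi psi1 r0 r3; have [l l1 lE] := cabs_rotate (psi 0).
set m := cabs (psi 0) in lE *; have m1 : m <= 1 by apply/psi1/cabs0_lt1.
have hlpsi : disk_smooth (fun z => - l * psi z) by apply: disk_smoothM => //; exact: disk_smooth_cst.
pose P z := 1 + - l * psi z.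
have hP : disk_smooth P by apply: disk_smoothD => //; exact: disk_smooth_cst.
have PRe z : cabs z < 1 -> 0 <= Re (P z).
  move=> /psi1 z1; rewrite /P ReD mulNr ReN /= subr_ge0.
  by apply: le_trans (Re_le_cabs _) _; rewrite cabsM l1 mul1r.
have P0 : P 0 = (1 - m)%:C by rewrite /P mulNr lE rmorphB.
have cn n : cabs (coef psi n.+1) <= 2 * (1 - m).
  have := caratheodory hP PRe P0 (ltn0Sn n); rewrite /P coefD//; last exact: disk_smooth_cst.
  by rewrite coef_cst add0r coefZ// cabsM cabsN l1 mul1r.
case: K => [|K]; first by rewrite /majorant big_ord0.
rewrite majorantS -/m.
have : majorant (div0 psi) r K <= 2 * (1 - m) / (1 - r).
  have r1 : 0 <= r < 1 by lra.
  apply: (@le_trans _ _ (\sum_(0 <= k < K) 2 * (1 - m) * r ^+ k)).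
    rewrite /majorant big_mkord; apply: ler_sum => k _.
    by rewrite ler_wpM2r ?exprn_ge0// -coefS.
  by rewrite -mulr_sumr ler_wpM2l ?geometric_sum_le//; lra.
have : r * (2 * (1 - m) / (1 - r)) <= 1 - m.
  rewrite mulrA ler_pdivrMr; last by lra.
  by have := mulr_ge0
    (_ : 0 <= 1 - m) (_ : 0 <= 1 - 3 * r); rewrite !subr_ge0 => /(_ m1 r3); lra.
move=> h1 h2; have := ler_wpM2l r0 h2; lra.
Qed.

(** Subordination does not increase the majorant series at radius at most
    [1/3]: one coefficient is split off at a time, and Bohr's theorem bounds the
    majorant of [psi]. *)
Lemma majorant_subordinate u psi r K : disk_smooth u -> disk_smooth psi ->
  (forall z, cabs z < 1 -> cabs (psi z) <= 1) -> 0 <= r -> 3 * r <= 1 ->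
  majorant (fun z => u (z * psi z)) r K <= majorant u r K.
Proof.
move=> hu hpsi psi1 r0 r3; elim: K u hu => [|K IH] u hu.
  by rewrite /majorant !big_ord0.
have zpsi z : cabs z < 1 -> cabs (z * psi z) < 1.
  move=> z1; rewrite cabsM; apply: (le_lt_trans _ z1).
  by rewrite ler_piMr ?cabs_ge0// psi1.
have hu1 := disk_smooth_div0 hu.
have hc : disk_smooth (fun z => div0 u (z * psi z)).
  by apply: disk_smooth_comp hu1 => //; apply: disk_smoothM => //; exact: disk_smooth_id.
rewrite (@majorant_cons _ (fun z => psi z * div0 u (z * psi z)) (u 0));
  [|exact: disk_smoothM|by move=> z /zpsi z1; rewrite (div0E hu z1) mulrA].
rewrite majorantS lerD2l ler_wpM2l//.
apply: le_trans (majorantM K r0 hpsi hc) _.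
apply: le_trans (IH _ hu1); rewrite ler_piMl ?majorant_ge0//.
exact: bohr.
Qed.

End bohr.

Section coefficient_bound.
Context {R : realType}.
Local Notation C := R[i].
Implicit Types (F Z P : C -> C) (z : C) (n : nat).

Lemma Re_inv_ge0 (q : C) : 0 <= Re q -> 0 <= Re q^-1.
Proof.
have [->|q0] := eqVneq q 0; first by rewrite invr0.
have -> : q^-1 = (cabs q ^- 2)%:C * q^*.
  apply: (mulfI q0); rewrite mulrCA mulfV// [q * _]mulrC conj_mul_cabs -rmorphM/= mulVf//.
  by rewrite expf_neq0// cabs_eq0.
move=> h; rewrite ReZ mulr_ge0// ?invr_ge0 ?exprn_ge0 ?cabs_ge0//.
by case: q h {q0}.
Qed.

(** [Z / F] is a function with nonnegative real part, and comparing the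
    coefficients of [Z = (Z / F) * F] gives a recursion for those of [F]. *)
Lemma starlike_coef_le F Z : disk_smooth F -> disk_smooth Z ->
  (forall n, coef Z n = n%:R * coef F n) -> F 0 = 0 -> coef F 1 = 1 ->
  (forall z, cabs z < 1 -> z != 0 -> F z != 0) ->
  (forall z, cabs z < 1 -> z != 0 -> 0 <= Re (Z z / F z)) ->
  forall n, cabs (coef F n) <= n%:R.
Proof.
move=> hF hZ ZF F0 F1 Fn0 ReZF; have Z0 : Z 0 = 0 by rewrite -coef0 ZF mul0r.
pose E := div0 F; pose Z1 := div0 Z.
have [hE hZ1] : disk_smooth E /\ disk_smooth Z1 by split; exact: disk_smooth_div0.
have FE z : cabs z < 1 -> F z = z * E z by move=> z1; rewrite div0E// F0 add0r.
have ZE z : cabs z < 1 -> Z z = z * Z1 z by move=> z1; rewrite div0E// Z0 add0r.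
have E0 : E 0 = 1 by rewrite -F1 coefS.
have Z10 : Z1 0 = 1 by rewrite -coef0 -coefS ZF F1 mulr1.
have En0 z : cabs z < 1 -> E z != 0.
  move=> z1; have [->|z0] := eqVneq z 0; first by rewrite E0 oner_neq0.
  by have := Fn0 _ z1 z0; rewrite FE// mulf_eq0 negb_or => /andP[].
pose P z := Z1 z * (E z)^-1.
have hP : disk_smooth P by apply: disk_smoothM => //; exact: disk_smoothV.
have P0 : P 0 = 1%:C by rewrite /P E0 Z10 invr1 mulr1.
have PRe z : cabs z < 1 -> 0 <= Re (P z).
  move=> z1; have [->|z0] := eqVneq z 0; first by rewrite P0 ler01.
  have := ReZF _ z1 z0; rewrite FE// ZE// /P.
  by rewrite invfM mulrACA mulfV// mul1r.
have p2 n : cabs (coef P n.+1) <= 2.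
  by have := caratheodory hP PRe P0 (ltn0Sn n); rewrite mulr1.
elim/ltn_ind => -[_|n IH]; first by rewrite coef0 F0 cabs0.
have rec : n%:R * coef F n.+1 = \sum_(i < n) coef P i.+1 * coef F (n - i)%N.
  have : coef Z1 n = \sum_(i < n.+1) coef P i * coef E (n - i)%N.
    rewrite -coefM//; apply: eq_coef; first exact: disk_smoothM.
    by move=> z z1; rewrite /P divfK// En0.
  rewrite -coefS ZF big_ord_recl/= subn0 -coefS coef0 P0 mul1r -natr1 mulrDl mul1r.
  rewrite addrC => /addrI ->; apply: eq_bigr => i _.
  by rewrite -coefS -subSn// subSS.
have [->|n0] := posnP n; first by rewrite F1 cabs1.
have nR : (0 : R) < n%:R by rewrite ltr0n.
rewrite -(ler_pM2l nR).
have -> : n%:R * cabs (coef F n.+1) = cabs (n%:R * coef F n.+1).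
  by rewrite cabsM -(rmorph_nat (real_complex R)) cabs_real ger0_norm.
rewrite rec; apply: (@le_trans _ _ (\sum_(i < n) 2 * (n - i)%:R)).
  elim/big_ind2: _ => [|x a y b xa yb|i _]; first by rewrite cabs0.
    by apply: le_trans (cabsD _ _) _; exact: lerD.
  rewrite cabsM; apply: ler_pM; rewrite ?cabs_ge0 ?p2// IH// ltnS.
  exact: leq_subr.
rewrite -mulr_sumr -natr_sum -!natrM ler_nat.
have -> : (\sum_(i < n) (n - i) = \sum_(i < n) i.+1)%N.
  rewrite (reindex_inj rev_ord_inj)/=; apply: eq_bigr => i _.
  by rewrite subnA ?subnn// ltnW.
have -> : (\sum_(i < n) i.+1 = \sum_(i < n.+1) i)%N by rewrite [RHS]big_ord_recl.
have := triangular_sum n.+1; rewrite big_mkord => ->.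
by rewrite bin2 /= mul2n [leqRHS]mulnC -[leqRHS]odd_double_half leq_addl.
Qed.

(** The Koebe series has the sum [r / (1 - r) ^+ 2]. *)
Lemma koebe_majorant_le (r : R) K : 0 <= r < 1 -> 4 * r <= (1 - r) ^+ 2 ->
  \sum_(k < K) k%:R * r ^+ k <= 4^-1.
Proof.
move=> /andP[r0 r1] r4; have d0 : 0 < (1 - r) ^+ 2 by rewrite exprn_gt0// subr_gt0.
apply: (@le_trans _ _ (r / (1 - r) ^+ 2)); last first.
  by rewrite ler_pdivrMr//; lra.
rewrite ler_pdivlMr//.
have -> : (\sum_(k < K) k%:R * r ^+ k) * (1 - r) ^+ 2 =
  r - (K%:R * (1 - r) + r) * r ^+ K.
  elim: K => [|K IH]; first by rewrite big_ord0; ring.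
  by rewrite big_ord_recr/= mulrDl IH [r ^+ K.+1]exprS -natr1; ring.
by rewrite gerBl mulr_ge0 ?exprn_ge0// addr_ge0// mulr_ge0// subr_ge0 ltW.
Qed.

End coefficient_bound.

(** * Starlike functions with a holomorphic inverse *)

Section starlike.
Context {R : realType}.
Local Notation C := R[i].
Implicit Types (a : nat -> C) (F h : C -> C) (z w : C) (n : nat).

(** The scalar data extracted from a starlike biholomorphic map, with [h] the
    inverse of [F] on its image.  Smoothness of order [1] is all that
    differentiability of the inverse gives; the higher orders are recovered in
    [starlike_inv_smooth_n]. *)
Record starlike_series a F h : Prop := {
  starlike_pseries : pseries_on_disk a F;
  starlike_at0 : F 0 = 0;
  starlike_coef1 : a 1%N = 1;
  starlike_invK : forall z, cabs z < 1 -> h (F z) = z;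
  starlike_open : forall z, cabs z < 1 ->
    \forall w \near F z, exists2 z', cabs z' < 1 & F z' = w;
  starlike_inv_smooth : forall z, cabs z < 1 -> smooth 1 h (F z);
  starlike_ray : forall z (t : R), cabs z < 1 -> 0 <= t <= 1 ->
    exists2 z', cabs z' < 1 & F z' = t%:C * F z }.

Context {a : nat -> C} {F h : C -> C}.

Lemma starlike_disk_smooth : starlike_series a F h -> disk_smooth F.
Proof. by case=> aF _ _ _ _ _ _; exact: pseries_disk_smooth aF. Qed.

Lemma starlike_inv0 : starlike_series a F h -> h 0 = 0.
Proof.
by move=> sF; have := starlike_invK sF cabs0_lt1; rewrite (starlike_at0 sF).
Qed.

Lemma starlike_neq0 : starlike_series a F h ->
  forall z, cabs z < 1 -> z != 0 -> F z != 0.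
Proof.
move=> sF z z1; apply: contra => /eqP Fz.
by rewrite -(starlike_invK sF z1) Fz (starlike_inv0 sF).
Qed.

(** The chain rule for [h (F y) = y], in divided differences; in particular
    [V z], the derivative of [F] at [z], does not vanish. *)
Lemma inverse_slope V K z : starlike_series a F h -> cabs z < 1 ->
  {for z, continuous V} -> (forall y, cabs y < 1 -> F y = F z + (y - z) * V y) ->
  {for F z, continuous K} ->
  (\forall w \near F z, h w = h (F z) + (w - F z) * K w) ->
  K (F z) * V z = 1.
Proof.
move=> sF z1 cV FV cK hK.
have cF : {for z, continuous F} := starlike_disk_smooth sF z1 0%N.
apply: (@punctured_eq _ (fun y => K (F y) * V y) (fun=> 1)).
- exact: (continuousM (continuous_comp cF cK) cV).
- exact: continuous_cst.
have hKF : \forall y \near z, h (F y) = h (F z) + (F y - F z) * K (F y).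
  exact: (cF _ hK).
apply: filterS2 hKF (disk_open z1) => y + y1 yz.
rewrite !(starlike_invK sF)// => yE; apply: (@mulfI _ (y - z)).
  by rewrite subr_eq0.
have FyE : F y - F z = (y - z) * V y by rewrite FV// addrC addKr.
rewrite mulr1 mulrCA -FyE mulrC.
by rewrite [RHS](congr1 (+%R^~ (- z)) yE) [RHS]addrC addKr.
Qed.

Lemma starlike_inv_smooth_n n z : starlike_series a F h -> cabs z < 1 ->
  smooth n h (F z).
Proof.
move=> sF z1; have hz := starlike_invK sF.
have [b [V [bV _ FV _]]] := pseries_divided_difference (starlike_pseries sF) z1.
have hV := pseries_disk_smooth bV.
have [K cK hK] := starlike_inv_smooth sF z1.
have KV := inverse_slope sF z1 (hV z z1 0%N) FV cK hK.
have ch : {for F z, continuous h}.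
  exact: smooth_continuous (starlike_inv_smooth sF z1).
apply: (smooth_inverse (w := V) ch).
- by rewrite hz// => m; exact: hV.
- by rewrite hz//; apply: contra_eq_neq KV => ->; rewrite mulr0 eq_sym oner_neq0.
- apply: filterS (starlike_open sF z1) => w [z' z'1 <-].
  by rewrite !hz// FV.
Qed.

Lemma inverse_disk_smooth u : starlike_series a F h -> disk_smooth u ->
  (forall z, cabs z < 1 -> exists2 z', cabs z' < 1 & F z' = u z) ->
  disk_smooth (fun z => h (u z)) /\ forall z, cabs z < 1 -> cabs (h (u z)) < 1 /\ F (h (u z)) = u z.
Proof.
move=> sF hu uF; split=> z z1; have [z' z'1 uE] := uF z z1; last first.
  by rewrite -uE (starlike_invK sF).
move=> n; apply: smooth_comp; first exact: hu.
by rewrite -uE; exact: starlike_inv_smooth_n.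
Qed.

(** The map [z |-> h (t F z)], whose image under [F] is the homothetic image of
    [F z], is a self-map of the disk fixing [0]: Schwarz's lemma applies. *)
Lemma starlike_contract (t : R) z : starlike_series a F h -> 0 <= t <= 1 ->
  cabs z < 1 -> cabs (h (t%:C * F z)) <= cabs z.
Proof.
move=> sF t01 z1.
have [hom hom1] := @inverse_disk_smooth (fun z => t%:C * F z) sF
  (disk_smoothM (disk_smooth_cst _) (starlike_disk_smooth sF)) (fun y y1 => starlike_ray sF y1 t01).
pose om z := h (t%:C * F z).
have om0 : om 0 = 0.
  by rewrite /om (starlike_at0 sF) mulr0 (starlike_inv0 sF).
have omE y : cabs y < 1 -> om y = y * div0 om y.
  by move=> y1; rewrite [LHS](div0E hom)// -/(om 0) om0 add0r.
rewrite -/(om z) omE// cabsM ler_piMr ?cabs_ge0//.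
apply: schwarz z1; first exact: disk_smooth_div0.
by move=> y y1; rewrite -omE// ltW//; case: (hom1 y y1).
Qed.

(** [F z * K (F z)] is the derivative at [t = 1] of [t |-> h (t F z)], whose
    modulus is at most [cabs z] for [t <= 1]. *)
Lemma starlike_Re_inverse_slope K z : starlike_series a F h -> cabs z < 1 ->
  {for F z, continuous K} ->
  (\forall w \near F z, h w = h (F z) + (w - F z) * K w) ->
  0 <= Re (z^* * (F z * K (F z))).
Proof.
move=> sF z1 cK hK; rewrite leNgt; apply/negP => neg.
pose g w := Re (z^* * (F z * K w)).
have cg : {for F z, continuous g}.
  apply: continuous_Re; apply: continuousM; first exact: continuous_cst.
  by apply: continuousM cK; exact: continuous_cst.
have ng : 0 < - g (F z) by rewrite oppr_gt0.
move/cvgrPdist_lt/(_ _ ng): cg => cg.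
have /nearC[d d0 dP] := near_and cg hK.
(* The point [(1 - s) F z] is within [d] of [F z], and on the segment from [0]
   to [F z]. *)
pose s := Num.min 1 (d / (cabs (F z) + 1)) / 2.
have Fz0 := cabs_ge0 (F z).
have s0 : 0 < s by rewrite divr_gt0// lt_min ltr01 divr_gt0// ltr_wpDl.
have s1 : s <= 1.
  have : Num.min 1 (d / (cabs (F z) + 1)) <= 1 by rewrite ge_min lexx.
  by rewrite /s; lra.
have sd : s * (cabs (F z) + 1) < d.
  have : Num.min 1 (d / (cabs (F z) + 1)) <= d / (cabs (F z) + 1).
    by rewrite ge_min lexx orbT.
  rewrite ler_pdivlMr ?ltr_wpDl//.
  by rewrite /s mulrAC; lra.
have wE : (1 - s)%:C * F z - F z = - (s%:C * F z).
  by rewrite rmorphB/=; ring.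
have [|gw hw] := dP ((1 - s)%:C * F z).
  rewrite wE cabsN cabsM cabs_real gtr0_norm//; lra.
have t01 : 0 <= 1 - s <= 1 by lra.
(* The contraction gives [cabs (z - s F z K) <= cabs z], whereas a negative
   real part of [z^* F z K] makes the left side the larger one. *)
have := starlike_contract sF t01 z1.
rewrite hw (starlike_invK sF)// wE.
set k := K _ in gw *; have : g ((1 - s)%:C * F z) < 0.
  by move: gw; rewrite ltr_norml => /andP[+ _]; lra.
rewrite {1}/g -/k mulNr -mulrA => gk.
rewrite -(@ler_pXn2r _ 2)// ?nnegrE ?cabs_ge0// !cabs_sqr; apply/negP; rewrite -ltNge.
move: gk; case: (F z * k) => x y; case: (z) => p q /=; nra.
Qed.

(** The hypothesis of [starlike_coef_le] holds with [Z z = z F' z]: by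
    [starlike_Re_inverse_slope], [F / Z], hence [Z / F], has nonnegative real
    part. *)
Lemma starlike_coef n : starlike_series a F h -> cabs (coef F n) <= n%:R.
Proof.
move=> sF; have hF := starlike_disk_smooth sF; have aF := starlike_pseries sF.
have /choice[Z ZP] z : exists y : C, cabs z < 1 ->
    (fun N => \sum_(0 <= k < N) (k%:R * a k) * z ^+ k) @ \oo --> y /\
    (z != 0 -> 0 <= Re (y / F z)).
  have [z1|z1] := ltP (cabs z) 1; last by exists 0.
  have [b [V [bV _ FV lim]]] := pseries_divided_difference aF z1.
  have [K cK hK] := starlike_inv_smooth sF z1.
  exists (z * V z) => _; split=> // z0.
  have KV := inverse_slope sF z1 (pseries_disk_smooth bV z1 0%N) FV cK hK.
  have := starlike_Re_inverse_slope sF z1 cK hK.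
  have V0 : V z != 0 by apply: contra_eq_neq KV => ->; rewrite mulr0 eq_sym oner_neq0.
  have -> : K (F z) = (V z)^-1 by rewrite -[RHS]mul1r -KV mulfK.
  have Fz := starlike_neq0 sF z1 z0.
  have -> : z^* * (F z / V z) = (cabs z ^+ 2)%:C * (z * V z / F z)^-1.
    by rewrite -conj_mul_cabs !invfM invrK; field; rewrite z0 V0.
  rewrite ReZ pmulr_rge0 ?exprn_gt0 ?cabs_gt0// => /Re_inv_ge0.
  by rewrite invrK.
have aZ : pseries_on_disk (fun k => k%:R * a k) Z by move=> z /ZP[].
apply: (@starlike_coef_le _ F Z) => //.
- exact: pseries_disk_smooth aZ.
- by move=> m; rewrite (coef_pseries _ aZ) (coef_pseries _ aF).
- exact: starlike_at0 sF.
- by rewrite (coef_pseries _ aF) (starlike_coef1 sF).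
- exact: starlike_neq0 sF.
- by move=> z /ZP[].
Qed.

(** The quarter bound.  The value [w = F z0] is omitted by [F] on the disk of
    radius [cabs z0], hence so is the ray from [w] to infinity, and
    [1 - F (cabs z0 * z) / w] has a square root [q] with positive real part.
    Caratheodory's inequality bounds its first coefficient
    [- cabs z0 / (2 * w)]. *)
Lemma starlike_quarter z0 : starlike_series a F h -> cabs z0 < 1 ->
  cabs z0 / 4 <= cabs (F z0).
Proof.
move=> sF z01; have [->|z00] := eqVneq z0 0; first by rewrite cabs0 mul0r cabs_ge0.
set rho := cabs z0; have rho0 : 0 < rho by rewrite cabs_gt0.
have hF := starlike_disk_smooth sF; have w0 := starlike_neq0 sF z01 z00; set w := F z0 in w0 *.
have rz z : cabs z < 1 -> cabs (rho%:C * z) < rho.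
  by move=> z1; rewrite cabsM cabs_real gtr0_norm// gtr_pMr.
have rz1 z : cabs z < 1 -> cabs (rho%:C * z) < 1 by move=> /rz /lt_trans; apply.
have hrz : disk_smooth (fun z => rho%:C * z) by apply: disk_smoothM; [exact: disk_smooth_cst|exact: disk_smooth_id].
pose u z := 1 - F (rho%:C * z) / w.
have hu : disk_smooth u.
  apply: disk_smoothB; first exact: disk_smooth_cst.
  by apply: disk_smoothM; [exact: disk_smooth_comp|exact: disk_smooth_cst].
have u_slit z (x : R) : cabs z < 1 -> 0 <= x -> u z <> - x%:C.
  move=> z1 x0 uz; have x1 : 0 < 1 + x by lra.
  have Fz : F (rho%:C * z) = (1 + x)%:C * w.
    have <- : (1 - u z) * w = F (rho%:C * z) by rewrite /u opprB addrC subrK divfK.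
    by rewrite uz opprK rmorphD.
  have t01 : 0 <= (1 + x)^-1 <= 1.
    by rewrite invr_ge0 ltW//= invf_le1//; lra.
  have := starlike_contract sF t01 (rz1 z z1).
  rewrite Fz mulrA -rmorphM/= mulVf ?gt_eqF// mul1r (starlike_invK sF)//.
  by rewrite leNgt rz.
have /choice[q qP] z : exists q : C, cabs z < 1 -> q ^+ 2 = u z /\ 0 < Re q.
  have [z1|z1] := ltP (cabs z) 1; last by exists 0.
  (* The square root is chosen up to sign, and its real part vanishes only if
     [u z] is a nonpositive real number. *)
  pose s := sqrtC (u z); have s2 : s ^+ 2 = u z by exact: sqrtCK.
  have [s0|s0|s0] := ltgtP 0 (Re s); first by exists s.
  - by exists (- s) => _; rewrite sqrrN ReN oppr_gt0.
  - exfalso; apply: (u_slit z (Im s ^+ 2)) => //; first exact: sqr_ge0.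
    rewrite -s2; case: (s) s0 => x y /= <-.
    by apply/eqP; rewrite eq_complex/= !expr2 /=; apply/andP; split; apply/eqP; ring.
have qq z y : cabs z < 1 -> cabs y < 1 -> q y + q z != 0.
  move=> /qP[_ qz] /qP[_ qy]; apply/eqP => /(congr1 (fun t => Re t)).
  by rewrite ReD/=; lra.
have qB z y : cabs z < 1 -> cabs y < 1 -> q y = q z + (u y - u z) / (q y + q z).
  move=> z1 y1; have [<- _] := qP z z1; have [<- _] := qP y y1.
  by rewrite subr_sqr mulfK ?qq// subrKC.
(* The identity [qB] gives continuity of [q], then one order of smoothness more
   at each step. *)
have hq : disk_smooth q.
  move=> z z1; elim=> [|n IH].
    apply/continuousC => e e0; have [_ qz] := qP z z1.
    have /continuousC/(_ (e * Re (q z))) := hu z z1 0%N.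
    rewrite mulr_gt0// => /(_ isT) cu.
    apply: filterS2 cu (disk_open z1) => y uyz y1; have [_ qy] := qP y y1.
    rewrite [q y](qB z)// [q z + _]addrC addrK cabsM cabsV ltr_pdivrMr ?cabs_gt0 ?qq//.
    apply: lt_le_trans uyz _; rewrite ler_wpM2l ?ltW//.
    have := Re_le_cabs (q y + q z); rewrite ReD; lra.
  have [u1 su1 uE] := hu z z1 n.+1.
  exists (fun y => u1 y * (q y + q z)^-1).
    apply: smoothM => //; apply: smoothV; first exact: qq.
    by apply: smoothD => //; exact: smooth_cst.
  apply: filterS2 uE (disk_open z1) => y uE y1.
  by rewrite [LHS](qB z)// uE [X in X / _]addrC addKr mulrA.
have u0 : u 0 = 1 by rewrite /u mulr0 (starlike_at0 sF) mul0r subr0.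
have q0 : q 0 = 1%:C.
  have [/eqP + q0p] := qP 0 cabs0_lt1.
  rewrite u0 sqrf_eq1 => /orP[/eqP->//|/eqP qN]; exfalso; move: q0p; rewrite qN /=; lra.
have := caratheodory (x := 1) hq (fun z zD => ltW (qP z zD).2) q0 (ltn0Sn 0).
have hv : disk_smooth (fun z => - (rho%:C / w) * div0 F (rho%:C * z)).
  apply: disk_smoothM; first exact: disk_smooth_cst.
  by apply: disk_smooth_comp => //; exact: disk_smooth_div0.
have uE z : cabs z < 1 -> u z = 1 + z * (- (rho%:C / w) * div0 F (rho%:C * z)).
  by move=> z1; rewrite /u (div0E hF (rz1 z z1)) (starlike_at0 sF) add0r; ring.
have : coef u 1 = - (rho%:C / w).
  rewrite (coef_cons 0 hv uE) /coef /= mulr0.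
  have -> : div0 F 0 = coef F 1 by rewrite coefS.
  by rewrite (coef_pseries _ (starlike_pseries sF)) (starlike_coef1 sF) mulr1.
have -> : coef u 1 = coef (fun z => q z * q z) 1.
  by apply: eq_coef; [exact: disk_smoothM|move=> z z1; rewrite -expr2; case: (qP z z1)].
rewrite coefM// big_ord_recl big_ord1 /= (_ : bump 0 0 = 1%N)//.
rewrite subn0 subnn !coef0 (q0 : q 0 = 1) mul1r mulr1.
have c2 (c : C) : cabs (c + c) = 2 * cabs c.
  have -> : c + c = (2 : R)%:C * c by rewrite rmorph_nat mulr_natl.
  by rewrite cabsM cabs_real ger0_norm.
move=> /(congr1 cabs); rewrite c2 cabsN cabsM cabsV cabs_real gtr0_norm// => qE q1.
have : rho / cabs w <= 4 by rewrite -qE; lra.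
by rewrite ler_pdivrMr ?cabs_gt0//; lra.
Qed.

(** The bound for subordinate functions: the Schwarz function is
    [phi = z * psi], whose [psi] is bounded by [1]. *)
Lemma starlike_subordinate_majorant G phi (r : R) K : starlike_series a F h ->
  disk_smooth phi -> phi 0 = 0 -> (forall z, cabs z < 1 -> cabs (phi z) < 1) ->
  (forall z, cabs z < 1 -> G z = F (phi z)) ->
  0 <= r -> 3 * r <= 1 -> 4 * r <= (1 - r) ^+ 2 ->
  majorant G r K <= 4^-1.
Proof.
move=> sF hphi phi0 phi1 GE r0 r3 r4; have hF := starlike_disk_smooth sF.
have hpsi := disk_smooth_div0 hphi.
have phiE z : cabs z < 1 -> phi z = z * div0 phi z.
  by move=> z1; rewrite [LHS](div0E hphi)// phi0 add0r.
have psi1 : forall z, cabs z < 1 -> cabs (div0 phi z) <= 1.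
  by apply: schwarz => // z z1; rewrite -phiE// ltW// phi1.
have -> : majorant G r K = majorant (fun z => F (z * div0 phi z)) r K.
  apply: eq_majorant => [|z z1]; last by rewrite GE// phiE.
  apply: disk_smooth_comp => //; last by apply: disk_smoothM => //; exact: disk_smooth_id.
  by move=> z z1; rewrite -phiE// phi1.
apply: le_trans (majorant_subordinate K hF hpsi psi1 r0 r3) _.
have r1 : 0 <= r < 1 by lra.
apply: le_trans (koebe_majorant_le K r1 r4); apply: ler_sum => k _.
by rewrite ler_wpM2r ?exprn_ge0// starlike_coef.
Qed.

End starlike.

(** * Differentials *)

Section differential.
Context {K : numFieldType}.

Lemma diff_near_id (V : normedModType K) (f : V -> V) (x : V) :
  (\forall y \near x, f y = y) -> 'd f x = id :> (V -> V).
Proof.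
move=> fE; apply: (@diff_unique _ _ _ f (idfun : {linear V -> V})).
  by move=> y; exact: cvg_id.
apply/eqaddoP => e e0; have fx := nbhs_singleton fE.
move: fE; rewrite (near_shift 0 x) subr0; apply: filterS => y /= fy.
by rewrite !fctE /= fy fx (addrC x) subrr normr0 mulr_ge0// ltW.
Qed.

Lemma differentiable_smooth (k : K -> K) (x : K) :
  differentiable k x -> smooth 1 k x.
Proof.
move=> dk; pose d := 'd k x 1.
exists (fun y => if y == x then d else (k y - k x) / (y - x)); last first.
  apply: near_all => y; case: eqVneq => [->|yx]; first by rewrite subrr mul0r addr0.
  by rewrite mulrC divfK ?subrKC// subr_eq0.
apply/(@cvgrPdist_lt _ _ _ (nbhs x)) => e e0; rewrite eqxx.
have de : \forall y \near (0 : K),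
    `|(k \o shift x - (cst (k x) + 'd k x)) y| <= e / 2 * `|y|.
  by have /eqaddoP := diff_locally dk; apply; rewrite divr_gt0.
move: de; rewrite (near_shift x 0) sub0r; apply: near_imp => y.
rewrite !fctE /= subrK; case: eqVneq => [-> _|yx]; first by rewrite subrr normr0.
have -> : 'd k x (y - x) = d * (y - x).
  have lin : 'd k x ((y - x) *: 1) = (y - x) *: d by rewrite linearZ.
  by rewrite mulrC -[RHS]lin; congr ('d k x _); rewrite /GRing.scale/= mulr1.
have yx0 : y - x != 0 by rewrite subr_eq0.
move=> h; rewrite distrC.
have -> : (k y - k x) / (y - x) - d = (k y - (k x + d * (y - x))) / (y - x).
  by field.
rewrite normrM normfV ltr_pdivrMr ?normr_gt0//; apply: le_lt_trans h _.
by rewrite ltr_pM2r ?normr_gt0// ltr_pdivrMr// ltr_pMr// ltr1n.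
Qed.

End differential.

(** * Operator spaces with only scalar operators *)

Section scalar_operators.
Context {R : realType} {H : completeNormedModType R[i]}.
Local Notation C := R[i].
Local Notation I := (idbop H).
Implicit Types (T : bop H) (c : C) (x : H).

Lemma bopZE c T x : (c *: T) x = c *: T x.
Proof. by []. Qed.

(** The differential of [f] at [0] is [c |-> c *: idbop H], and the chain rule for
    [f (h T) = T] makes it surjective. *)
Lemma biholomorphic_scalar_operators (f : C -> bop H) :
  biholomorphic (unit_disk R) f -> f 0 = 0 -> is_derive (0 : C) (1 : C) f I ->
  forall T, exists c, T = c *: I.
Proof.
move=> [hol [_ openfD _] [h [hK hh]]] f0 df T.
have D0 : unit_disk R 0 by apply/disk_cabs; rewrite cabs0.
have dif : differentiable f 0 := hol 0 D0.
have D0' : (f @` unit_disk R) 0 by exists 0.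
have dih : differentiable h 0 := hh 0 D0'.
have h0 : h 0 = 0 by rewrite -{1}f0 hK.
have dfE (c : C) : 'd f 0 c = c *: I.
  have d1 : 'd f 0 (1 : C) = I by rewrite -deriveE//; exact: derive_val.
  have lin : 'd f 0 (c *: (1 : C)) = c *: 'd f 0 (1 : C) by rewrite linearZ.
  by rewrite -d1 -lin; congr ('d f 0 _); rewrite /GRing.scale/= mulr1.
have fhK : \forall T \near (0 : bop H), (f \o h) T = T.
  have : nbhs (0 : bop H) (f @` unit_disk R) by apply: open_nbhs_nbhs.
  by apply: near_imp => _ [z Dz <-]; rewrite /= hK.
have dif' : differentiable f (h 0) by rewrite h0.
exists ('d h 0 T); rewrite -dfE -[LHS]/(id T) -(diff_near_id fhK).
by rewrite (diff_comp dih dif') h0.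
Qed.

(** If [H] were trivial then so would be [bop H], and [f] could not be injective. *)
Lemma biholomorphic_unit_vector (f : C -> bop H) :
  biholomorphic (unit_disk R) f -> exists x : H, `|x| = 1.
Proof.
move=> [_ _ [h [hK _]]].
have D0 : unit_disk R 0 by apply/disk_cabs; rewrite cabs0.
have D1 : unit_disk R (2^-1 : R)%:C by apply/disk_cabs; rewrite cabs_real ger0_norm; lra.
have [x x0] : exists x : H, x != 0.
  apply: contrapT => /forallNP all0.
  have fE : f 0 = f (2^-1 : R)%:C.
    by apply: bop_eqP => x; rewrite (_ : x = 0) ?bop0//; apply/eqP/negPn/negP/all0.
  have := hK _ D1; rewrite -fE hK// => /(congr1 cabs).
  by rewrite cabs0 cabs_real ger0_norm; lra.
by exists (`|x|^-1 *: x); rewrite normrZ normfV normr_id mulVf// normr_eq0.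
Qed.

Hypothesis unit_vector : exists x : H, `|x| = 1.

Lemma opnorm_scalar c : opnorm (c *: I) = cabs c.
Proof.
have [x x1] := unit_vector; apply/eqP; rewrite eq_le; apply/andP; split.
  apply: opnorm_le => y y1; rewrite -lecR -Defs.normcE -cabsE bopZE normrZ.
  by rewrite ler_piMr.
have := opnorm_ub (c *: I) (_ : `|x| <= 1); rewrite x1 => /(_ (lexx _)).
by rewrite bopZE normrZ x1 mulr1.
Qed.

Lemma scalar_operator_inj : injective (fun c : C => c *: I).
Proof.
move=> c d /eqP; rewrite -subr_eq0 -scalerBl => /eqP cd0.
have := opnorm_scalar (c - d); rewrite cd0 => /esym/eqP; rewrite (_ : opnorm 0 = 0).
  by rewrite cabs_eq0 subr_eq0 => /eqP.
by rewrite -(scale0r I) opnorm_scalar cabs0.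
Qed.

Lemma cvg_scalar_operator (s : nat -> C) (l : C) :
  (fun N => s N *: I) @ \oo --> l *: I <-> s @ \oo --> l.
Proof.
have nE N : `|l *: I - s N *: I| = (cabs (s N - l))%:C.
  by rewrite -scalerBl bop_normE opnorm_scalar cabsB.
split=> [/cvgrPdist_lt sl|/cvgC sl].
  apply/cvgC => e e0; have := sl e%:C; rewrite ltcR => /(_ e0).
  by apply: filterS => N; rewrite nE ltcR.
apply/cvgrPdist_lt => e e0.
have eE : e = (Re e)%:C by rewrite RRe_real// gtr0_real.
by move: e0; rewrite eE ltcR => /sl; apply: filterS => N; rewrite nE ltcR.
Qed.

End scalar_operators.

Section scalar_adjoint.
Context {R : realType} {H : completeNormedModType R[i]}.
Context {dot : {dot H for @Num.conj R[i]}}.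
Local Notation C := R[i].
Local Notation I := (idbop H).
Implicit Types (T : bop H) (c : C) (x y : H).

Lemma dotZl c x y : dot (c *: x) y = c * dot x y.
Proof. by rewrite linearZl_LR. Qed.

Lemma dotZr c x y : dot x (c *: y) = Num.conj c * dot x y.
Proof. by rewrite linearZr_LR. Qed.

Hypothesis dot_norm : forall x : H, dot x x = `|x| ^+ 2.
Hypothesis scalar : forall T, exists c : C, T = c *: I.
Hypothesis unit_vector : exists x : H, `|x| = 1.

Lemma scalar_adjointP c : is_adjoint dot (c *: I) (Num.conj c *: I).
Proof. by move=> x y; rewrite !bopZE dotZl dotZr conjCK. Qed.

Lemma adjoint_scalar c : adjoint dot (c *: I) = Num.conj c *: I.
Proof.
rewrite /adjoint; case: xgetP => [B _ adjB|/(_ _ (scalar_adjointP c))//].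
have [d dE] := scalar B; have [x x1] := unit_vector.
move: adjB => /(_ x x); rewrite dE !bopZE dotZl dotZr dot_norm x1 expr1n !mulr1.
by move=> ->; rewrite conjCK.
Qed.

Lemma real_selfadjoint (s : R) : selfadjoint dot (s%:C *: I).
Proof.
have := scalar_adjointP s%:C; rewrite /selfadjoint.
by have -> : Num.conj s%:C = s%:C by apply/CrealP; rewrite complex_real.
Qed.

Lemma op_le_scalar (s t : R) : s <= t -> op_le dot (s%:C *: I) (t%:C *: I).
Proof.
move=> st; split; [exact: real_selfadjoint|exact: real_selfadjoint|move=> x].
by rewrite !bopZE !dotZl dot_norm ler_wpM2r ?exprn_ge0// lecR.
Qed.

(** The adjoint and the positive root are scalars like all operators, and the
    defining conditions then determine them. *)
Lemma absop_scalar c : absop dot (c *: I) = (cabs c)%:C *: I.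
Proof.
have adjE : compbop (adjoint dot (c *: I)) (c *: I) = (cabs c ^+ 2)%:C *: I.
  apply: bop_eqP => x; rewrite adjoint_scalar -conj_mul_cabs.
  by rewrite -[LHS]/(Num.conj c *: (c *: x)) -[RHS]/(_ *: x) scalerA.
have sq (p : C) : compbop (p *: I) (p *: I) = (p ^+ 2) *: I.
  apply: bop_eqP => x.
  by rewrite -[LHS]/(p *: (p *: x)) -[RHS]/(_ *: x) scalerA expr2.
rewrite /absop; case: xgetP => [P _ [[_ _ P0] P2]|].
  have [p pE] := scalar P; have [x x1] := unit_vector.
  move: P0 => /(_ x); rewrite pE !bopZE dotZl dot_norm x1 expr1n mulr1.
  have -> : dot ((0 : bop H) x) x = 0.
    by rewrite -(scale0r I) bopZE dotZl mul0r.
  move=> p0; move: P2; rewrite adjE pE sq => /(scalar_operator_inj unit_vector).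
  rewrite rmorphXn/= => /eqP; rewrite eqrXn2// ?ler0c ?cabs_ge0//.
  by move=> /eqP ->.
move=> /(_ ((cabs c)%:C *: I))/not_andP[]; last by rewrite adjE sq rmorphXn.
by move=> []; rewrite -[0](scale0r I); apply: op_le_scalar; exact: cabs_ge0.
Qed.

End scalar_adjoint.

(** * From operators to scalars *)

Section scalar_reduction.
Context {R : realType} {H : completeNormedModType R[i]}.
Local Notation C := R[i].
Local Notation I := (idbop H).

(** The inverse of [F] is the inverse of [f], restricted to the line spanned by
    the identity. *)
Lemma starlike_series_of_scalar (f : C -> bop H) (A : nat -> bop H)
    (F : C -> C) (a : nat -> C) :
  (exists x : H, `|x| = 1) ->
  starlike_biholomorphic (unit_disk R) f ->
  (forall z, unit_disk R z ->
    (fun N : nat => z *: I + \sum_(2 <= n < N) z ^+ n *: A n) @ \oo --> f z) ->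
  (forall z, f z = F z *: I) -> (forall n, A n = a n *: I) ->
  exists h, starlike_series (fun n => if n is n'.+2 then a n else n%:R) F h.
Proof.
move=> uv [[bih D0 star] f0] fA fE AE.
have [holf [_ openfD _] [h [hK holh]]] := bih.
have inj := scalar_operator_inj uv.
have F0 : F 0 = 0 by apply: inj; rewrite -fE f0 scale0r.
have contI (w : C) : {for w, continuous (fun c : C => c *: I)}.
  exact: (@scalel_continuous _ _ I).
exists (fun w => h (w *: I)); split=> //.
- move=> z /disk_cabs Dz; apply/(cvg_scalar_operator uv); rewrite -fE.
  have := fA z Dz; rewrite -(cvg_shiftn 2) -[X in _ -> X](cvg_shiftn 2).
  set u := fun N => _ *: _ + _; set v := fun N => _ *: _.
  suff -> : u = v by [].
  apply/funext => N; rewrite /u /v addn2 [in RHS]big_ltn// [in RHS]big_ltn//.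
  rewrite mul0r add0r expr1 mul1r scalerDl scaler_suml; congr (_ + _).
  by apply: eq_big_nat => -[|[|n]]// _; rewrite AE scalerA mulrC.
- by move=> z /disk_cabs Dz; rewrite -fE hK.
- move=> z /disk_cabs Dz.
  have nD : nbhs (F z *: I) (f @` unit_disk R).
    by rewrite -fE; apply: open_nbhs_nbhs; split=> //; exists z.
  have nDw : \forall w \near F z, (f @` unit_disk R) (w *: I).
    exact: (contI (F z) _ nD).
  apply: near_imp nDw => w [z' Dz' fz']; exists z'; first exact/disk_cabs.
  by apply: inj; rewrite -fE.
- move=> z /disk_cabs Dz; apply: differentiable_smooth.
  apply: (@differentiable_comp _ _ _ _ (fun c : C => c *: I) h).
    by apply: differentiableZl; exact: (@ex_diff _ _ _ _ _ _ _ (is_diff_id _)).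
  by rewrite -fE; apply: holh; exists z.
- move=> z t /disk_cabs Dz t01; have [z' Dz' fz'] := star z t Dz t01.
  exists z'; first exact/disk_cabs.
  by apply: inj; rewrite -fE fz' f0 scaler0 add0r fE scalerA.
Qed.

End scalar_reduction.

(** * The theorem *)

Theorem theorem4 (R : realType) (H : completeNormedModType R[i])
    (dot : {dot H for @Num.conj R[i]})
    (dot_norm : forall x : H, dot x x = `|x| ^+ 2)
    (f g : R[i] -> bop H) (A B : nat -> bop H) :
  starlike_biholomorphic (unit_disk R) f ->
  normalized f ->
  (forall z : R[i], unit_disk R z ->
    (fun N : nat => z *: idbop H + \sum_(2 <= n < N) z ^+ n *: A n) @ \oo
      --> f z) ->
  subordinate f g ->
  (forall z : R[i], unit_disk R z ->
    (fun N : nat => \sum_(0 <= k < N) z ^+ k *: B k) @ \oo --> g z) ->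
  forall r : R, 0 <= r <= 3 - 2 * Num.sqrt 2 ->
  (\sum_(1 <= k <oo) (opnorm (B k) * r ^+ k)%:E
     <= limf_einf (fun z => (opnorm (f z))%:E) (norm_to_1 R))%E
  /\
  (exists2 S : bop H,
     (fun N : nat => \sum_(1 <= k < N) (r ^+ k)%:C *: absop dot (B k)) @ \oo
       --> S
     & op_le dot S (4^-1 *: idbop H)).
Proof.
move=> starf [f0 df] fA [_ [phi [_ phi0 phi1 gE]]] gB r /andP[r0 r3].
have [[bihf D0 _] _] := starf.
have scalar := biholomorphic_scalar_operators bihf f0 df.
have uv := biholomorphic_unit_vector bihf.
have /choice[F fE] z : exists c : R[i], f z = c *: idbop H by exact: scalar.
have /choice[G gGE] z : exists c : R[i], g z = c *: idbop H by exact: scalar.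
have /choice[a AE] n : exists c : R[i], A n = c *: idbop H by exact: scalar.
have /choice[b BE] n : exists c : R[i], B n = c *: idbop H by exact: scalar.
have inj := scalar_operator_inj uv.
have [h sF] := starlike_series_of_scalar uv starf fA fE AE.
have bG : pseries_on_disk b G.
  move=> z /disk_cabs Dz; apply/(cvg_scalar_operator uv); rewrite -gGE.
  apply: cvg_trans (gB z Dz); apply: near_eq_cvg; apply: nearW => N /=.
  by rewrite scaler_suml; apply: eq_bigr => k _; rewrite BE scalerA mulrC.
have GE z : cabs z < 1 -> G z = F (phi z).
  by move=> /disk_cabs Dz; apply: inj; rewrite -gGE gE// fE.
have phiD z : cabs z < 1 -> cabs (phi z) < 1.
  by move=> /disk_cabs /phi1; rewrite cabsE ltcR.
have hphi : disk_smooth phi.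
  have [] := @inverse_disk_smooth _ _ _ _ G sF (pseries_disk_smooth bG).
    by move=> z z1; exists (phi z); [exact: phiD|rewrite GE].
  move=> hhG _; apply: disk_smooth_eq hhG => z z1.
  by rewrite GE// (starlike_invK sF)// phiD.
pose s := Num.sqrt (2 : R); have s0 : 0 <= s by exact: sqrtr_ge0.
have s2 : s ^+ 2 = 2 by rewrite sqr_sqrtr.
rewrite -/s in r3; rewrite expr2 in s2.
(* With [s] the square root of [2], [3 - 2 * s] is below [1/3] and is a root
   of [4 * r = (1 - r) ^+ 2]. *)
have r3' : 3 * r <= 1 by nra.
have r4 : 4 * r <= (1 - r) ^+ 2 by rewrite expr2; nra.
have term_ge0 k : 0 <= opnorm (B k) * r ^+ k by rewrite mulr_ge0 ?opnorm_ge0 ?exprn_ge0.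
have partial_le N : \sum_(1 <= k < N) opnorm (B k) * r ^+ k <= 4^-1.
  case: N => [|N]; first by rewrite big_geq// invr_ge0.
  apply: le_trans (starlike_subordinate_majorant N.+1 sF hphi phi0 phiD GE r0 r3' r4).
  rewrite /majorant -(big_mkord xpredT (fun k => cabs (coef G k) * r ^+ k)) big_ltn//.
  rewrite ler_wpDl ?mulr_ge0 ?cabs_ge0 ?exprn_ge0//.
  by apply: ler_sum => k _; rewrite (coef_pseries _ bG) BE opnorm_scalar.
split.
  apply: (@le_trans _ _ (4^-1)%:E).
    apply: lime_le.
      by apply: is_cvg_nneseries => k _ _; rewrite lee_fin.
    by apply: nearW => N; rewrite sumEFin lee_fin.
  rewrite /limf_einf /= leeNr; apply/lee_addgt0Pr => e e0.
  apply: ge_ereal_inf; exists (ereal_sup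
      [set (- (opnorm (f z))%:E)%E | z in [set z : R[i] | (1 - e)%:C < `|z| < 1]]).
    exists [set z : R[i] | (1 - e)%:C < `|z| < 1] => //.
    by exists (1 - e) => //=; rewrite ltrBlDr ltrDl.
  apply: ge_ereal_sup => _ [z /andP[+ +] <-]; rewrite cabsE !ltcR => ez z1.
  have := starlike_quarter sF z1; rewrite fE opnorm_scalar//.
  by rewrite -!EFinN -EFinD lee_fin; lra.
have absB k : (r ^+ k)%:C *: absop dot (B k) =
    (opnorm (B k) * r ^+ k)%:C *: idbop H.
  by rewrite BE (absop_scalar dot_norm scalar uv) opnorm_scalar// scalerA -rmorphM mulrC.
pose t N := \sum_(1 <= k < N) opnorm (B k) * r ^+ k.
have ndt : {homo t : n m / (n <= m)%N >-> n <= m}.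
  apply/nondecreasing_seqP => -[|n]; first by rewrite /t !big_geq.
  by rewrite /t [leRHS]big_nat_recr//= lerDl.
have cvt : cvgn t.
  by apply: nondecreasing_is_cvgn ndt _; exists 4^-1 => _ [N _ <-]; exact: partial_le.
exists ((limn t)%:C *: idbop H).
  have -> : (fun N => \sum_(1 <= k < N) (r ^+ k)%:C *: absop dot (B k)) =
      (fun N => (t N)%:C *: idbop H).
    apply/funext => N; rewrite /t rmorph_sum scaler_suml.
    by apply: eq_bigr => k _; exact: absB.
  apply/(cvg_scalar_operator uv)/cvgC => e e0.
  move/cvgrPdist_lt/(_ e e0): cvt; apply: filterS => N.
  by rewrite -rmorphB/= cabs_real distrC.
have -> : (4^-1 : R[i]) = (4^-1 : R)%:C by rewrite fmorphV rmorph_nat.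
apply: op_le_scalar => //; apply: limr_le => //.
by apply: nearW => N; exact: partial_le.
Qed.
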